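(* Let $m\ge 1$ and $k\ge 0$ be integers. There exists a surjection of $\mathfrak{so}_{2m+1}$-modules $$A_{[2]}(\mathfrak{so}_{2m+1};k)\ \to\ \bigoplus_{\substack{\lambda=\sum_{i=1}^m a_i\omega_i\\ (\sum_{i=1}^{m-1}2a_i)+a_m\le k\\ k-a_m\equiv 0\ (\mathrm{mod}\ 2)}}V(\lambda)\otimes V(\lambda)^*,$$ where the $a_i$ are non-negative integers.
   Context: Ground field $\mathbb C$. $e_\theta$ is a highest root vector of $\mathfrak g=\mathfrak{so}_{2m+1}$. The $C_2$-algebra is $A_{[2]}(\mathfrak{g};k)=S^\bullet(\mathfrak{g})/\langle \mathrm U(\mathfrak{g})\circ e_\theta^{k+1}\rangle$, where $\circ$ is the action of $\mathfrak g$ on its symmetric algebra induced by the adjoint action and $\langle\cdot\rangle$ denotes the generated ideal; it is a $\mathfrak g$-module via the induced action. $V(\lambda)$ is the irreducible $\mathfrak{so}_{2m+1}$-module of highest weight $\lambda$. Fundamental weights (Bourbaki, type $B_m$): $\omega_i=\epsilon_1+\dots+\epsilon_i$ for $i\le m-1$ and $\omega_m=\frac12(\epsilon_1+\dots+\epsilon_m)$. The right hand side is a $\mathfrak g$-module via the diagonal action on tensor products. *)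

(* Defs.v *)
From HB Require Import structures.
From mathcomp Require Import all_boot all_algebra.
From mathcomp Require Import ring_quotient mpoly complex boolp reals ring.

Set Implicit Arguments.
Unset Strict Implicit.
Unset Printing Implicit Defensive.

Import GRing.Theory.
Local Open Scope ring_scope.

Section LieModules.
Variable K : fieldType.

Record lieAlgebra := LieAlgebra {
  lie_sort :> vectType K;
  lbr : lie_sort -> lie_sort -> lie_sort;
  lbr_linl : forall y, linear (lbr^~ y);
  lbr_linr : forall x, linear (lbr x);
  lbrxx : forall x, lbr x x = 0;
  lbrJ : forall x y z, lbr x (lbr y z) + lbr y (lbr z x) + lbr z (lbr x y) = 0 }.

Section LieAlgebraTheory.
Variable g : lieAlgebra.
Implicit Types x y z : g.

Lemma lbrDl x y z : lbr (x + y) z = lbr x z + lbr y z.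
Proof. by have := lbr_linl z 1 x y; rewrite !scale1r. Qed.

HB.instance Definition _ (x : g) :=
  GRing.isLinear.Build K g g _ (lbr x) (@lbr_linr g x).

Lemma lbrC x y : lbr x y = - lbr y x.
Proof.
have := lbrxx (x + y); rewrite lbrDl !linearD /= !lbrxx add0r addr0.
by move/eqP; rewrite addr_eq0 => /eqP.
Qed.

Lemma lbr_der x y z : lbr (lbr x y) z = lbr x (lbr y z) - lbr y (lbr x z).
Proof.
have := lbrJ x y z; rewrite [lbr z (lbr x y)]lbrC [lbr z x]lbrC linearN /=.
by move/eqP; rewrite subr_eq0 => /eqP.
Qed.

End LieAlgebraTheory.

Record lieAction (g : lieAlgebra) (V : lmodType K) := LieAction {
  lact :> g -> V -> V;
  lact_linl : forall v, linear (lact^~ v);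
  lact_linr : forall x, linear (lact x);
  lact_lbr : forall x y v,
    lact (lbr x y) v = lact x (lact y v) - lact y (lact x v) }.

Definition equivariant (g : lieAlgebra) (V W : lmodType K)
    (rho : lieAction g V) (sigma : lieAction g W) (f : V -> W) :=
  forall x v, f (rho x v) = sigma x (f v).

Definition is_surjective (A B : Type) (f : A -> B) := forall b, exists a, f a = b.

Definition is_irreducible (g : lieAlgebra) (V : vectType K) (rho : lieAction g V) :=
  (0 < \dim {:V})%N /\
  forall U : {vspace V}, (forall x, {in U, forall u, rho x u \in U}) ->
    U = 0%VS \/ U = fullv.

End LieModules.

Section ActTheory.
Variables (K : fieldType) (g : lieAlgebra K) (V : lmodType K).
Variable rho : lieAction g V.

HB.instance Definition _ (x : g) :=
  GRing.isLinear.Build K V V _ (rho x) (lact_linr rho x).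

Lemma lactDl x y v : rho (x + y) v = rho x v + rho y v.
Proof. by have := lact_linl rho v 1 x y; rewrite !scale1r. Qed.

Lemma lact0l v : rho 0 v = 0.
Proof. by apply: (addIr (rho 0 v)); rewrite -lactDl !add0r. Qed.

Lemma lactZl a x v : rho (a *: x) v = a *: rho x v.
Proof. by have := lact_linl rho v a x 0; rewrite lact0l !addr0. Qed.

End ActTheory.

Record subspace (K : fieldType) (V : lmodType K) := Subspace {
  smem :> V -> Prop;
  smem0 : smem 0;
  smem_lin : forall a u v, smem u -> smem v -> smem (a *: u + v) }.

Section Quotient.
Variables (K : fieldType) (V : lmodType K) (I : subspace V).

Definition smemb : {pred V} := fun v => `[< I v >].

Fact smemb_submod_closed : submod_closed smemb.
Proof.
split=> [|a u v /asboolP Iu /asboolP Iv]; apply/asboolP; first exact: smem0.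
exact: smem_lin.
Qed.
HB.instance Definition _ :=
  GRing.isSubmodClosed.Build K V smemb smemb_submod_closed.

Definition lquot := Quotient.quot smemb.
HB.instance Definition _ := GRing.Zmodule.on lquot.

Definition lproj (v : V) : lquot := (\pi_(Quotient.quot smemb) v)%qT.

Lemma lproj_eq u v : (lproj u == lproj v) = (u - v \in smemb).
Proof. by rewrite Quotient.idealrBE. Qed.

Lemma lprojK (q : lquot) : lproj (repr q) = q.
Proof. exact: reprK. Qed.

Lemma lprojD u v : lproj (u + v) = lproj u + lproj v.
Proof. by rewrite /lproj; exact: Quotient.pi_add. Qed.

Definition lquot_scale (a : K) (q : lquot) : lquot := lproj (a *: repr q).

Lemma lproj_scale a v : lquot_scale a (lproj v) = lproj (a *: v).
Proof.
apply/eqP; rewrite lproj_eq -scalerBr rpredZ //.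
by rewrite -lproj_eq lprojK.
Qed.

Fact lquot_scaleA a b q :
  lquot_scale a (lquot_scale b q) = lquot_scale (a * b) q.
Proof. by rewrite -[q]lprojK !lproj_scale scalerA. Qed.

Fact lquot_scale1 : left_id 1 lquot_scale.
Proof. by move=> q; rewrite -[q]lprojK lproj_scale scale1r. Qed.

Fact lquot_scaleDr : right_distributive lquot_scale +%R.
Proof.
move=> a p q; rewrite -[p]lprojK -[q]lprojK.
by rewrite -lprojD !lproj_scale scalerDr lprojD.
Qed.

Fact lquot_scaleDl q : {morph lquot_scale^~ q : a b / a + b}.
Proof.
by move=> a b; rewrite -[q]lprojK !lproj_scale scalerDl lprojD.
Qed.

HB.instance Definition _ := GRing.Zmodule_isLmodule.Build K lquot
  lquot_scaleA lquot_scale1 lquot_scaleDr lquot_scaleDl.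

Fact lproj_linear : linear lproj.
Proof. by move=> a u v; rewrite lprojD -lproj_scale. Qed.

HB.instance Definition _ :=
  GRing.isLinear.Build K V lquot _ lproj lproj_linear.

Variables (g : lieAlgebra K) (rho : lieAction g V).
Hypothesis rhoI : forall x v, I v -> I (rho x v).

Definition quot_act (x : g) (q : lquot) : lquot := lproj (rho x (repr q)).

Lemma quot_actE x v : quot_act x (lproj v) = lproj (rho x v).
Proof.
apply/eqP; rewrite lproj_eq -linearB; apply/asboolP/rhoI/asboolP.
by move: (lproj_eq (repr (lproj v)) v); rewrite lprojK eqxx => /esym.
Qed.

Fact quot_act_linl q : linear (quot_act^~ q).
Proof.
move=> a x y; rewrite -[q]lprojK !quot_actE -linearP.
by rewrite lact_linl.
Qed.

Fact quot_act_linr x : linear (quot_act x).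
Proof.
move=> a p q; rewrite -[p]lprojK -[q]lprojK -linearP !quot_actE.
by rewrite !linearP.
Qed.

Fact quot_act_lbr x y q :
  quot_act (lbr x y) q = quot_act x (quot_act y q) - quot_act y (quot_act x q).
Proof. by rewrite -[q]lprojK !quot_actE -linearB lact_lbr. Qed.

Definition quotientAction : lieAction g lquot :=
  LieAction quot_act_linl quot_act_linr quot_act_lbr.

End Quotient.

Section SymmetricAlgebra.
Variables (K : fieldType) (g : lieAlgebra K).
Let n : nat := \dim {:g}.
Let b := vbasis {:g}.

(* S(g): polynomials in the elements of the fixed basis b of g. *)
Definition symAlg := {mpoly K[n]}.
HB.instance Definition _ := GRing.ComAlgebra.on symAlg.

Definition sym_in (x : g) : symAlg := \sum_(i < n) coord b i x *: 'X_i.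

Fact sym_in_linear : linear sym_in.
Proof.
move=> a x y; rewrite /sym_in scaler_sumr -big_split /=; apply: eq_bigr => i _.
by rewrite linearP scalerDl scalerA.
Qed.
HB.instance Definition _ := GRing.isLinear.Build K g symAlg _ sym_in sym_in_linear.

(* The derivation of S(g) extending ad x (see sym_act_in and sym_actM). *)
Definition sym_act (x : g) (p : symAlg) : symAlg :=
  \sum_(i < n) sym_in (lbr x b`_i) * p^`M(i).

Fact sym_act_linl p : linear (sym_act^~ p).
Proof.
move=> a x y; rewrite /sym_act scaler_sumr -big_split /=; apply: eq_bigr => i _.
by rewrite lbr_linl linearP mulrDl scalerAl.
Qed.

Fact sym_act_linr x : linear (sym_act x).
Proof.
move=> a p q; rewrite /sym_act scaler_sumr -big_split /=; apply: eq_bigr => i _.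
by rewrite linearP mulrDr scalerAr.
Qed.
HB.instance Definition _ x :=
  GRing.isLinear.Build K symAlg symAlg _ (sym_act x) (sym_act_linr x).

Lemma sym_actM x p q : sym_act x (p * q) = sym_act x p * q + p * sym_act x q.
Proof.
rewrite /sym_act [X in X + _]mulr_suml [X in _ + X]mulr_sumr -big_split /=.
by apply: eq_bigr => i _; rewrite mderivM mulrDr -mulrA [p * _]mulrCA.
Qed.

Lemma sym_actX x i : sym_act x 'X_i = sym_in (lbr x b`_i).
Proof.
rewrite /sym_act (bigD1 i) //= big1 => [|j nji].
  rewrite mderivX mnm1E eqxx scale1r addr0.
  have -> : (U_(i) - U_(i))%MM = 0%MM :> 'X_{1.. n}.
    by apply/mnmP => j; rewrite mnmBE mnm0E subnn.
  by rewrite mpolyX0 mulr1.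
by rewrite mderivX mnm1E eq_sym (negPf nji) scale0r mulr0.
Qed.

Lemma sym_act_in x y : sym_act x (sym_in y) = sym_in (lbr x y).
Proof.
rewrite {2}(coord_vbasis (memvf y)) !linear_sum /=.
by apply: eq_bigr => i _; rewrite !linearZ /= sym_actX.
Qed.

Lemma sym_act1 x : sym_act x 1 = 0.
Proof.
by rewrite /sym_act big1 // => i _; rewrite -mpolyC1 mderivC mulr0.
Qed.

Lemma sym_derivation_ext (D1 D2 : symAlg -> symAlg) :
  linear D1 -> linear D2 ->
  (forall p q, D1 (p * q) = D1 p * q + p * D1 q) ->
  (forall p q, D2 (p * q) = D2 p * q + p * D2 q) ->
  (forall i : 'I_n, D1 'X_i = D2 'X_i) -> D1 =1 D2.
Proof.
move=> l1 l2 m1 m2 e.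
have one (D : symAlg -> symAlg) : (forall p q, D (p * q) = D p * q + p * D q) -> D 1 = 0.
  move=> mD; have := mD 1 1; rewrite !mulr1 mul1r.
  by move=> /(congr1 (fun z => z - D 1)); rewrite subrr addrK => <-.
  have zero (D : symAlg -> symAlg) : linear D -> D 0 = 0.
  by move=> lD; have := lD (-1) 0 0; rewrite scaler0 add0r scaleN1r addNr.
have mon (m : 'X_{1.. n}) : D1 'X_[m] = D2 'X_[m].
  rewrite mpolyXE_id; elim/big_rec: _ => [|i q _ IH]; first by rewrite !one.
  rewrite m1 m2 IH; congr (_ * _ + _).
  elim: (m i) => [|k IHk]; first by rewrite !one.
  by rewrite exprS m1 m2 IHk e.
move=> p; elim/mpolyind: p => [|c m p _ _ IH]; first by rewrite !zero.
by rewrite l1 l2 mon IH.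
Qed.

Fact sym_act_lbr x y p :
  sym_act (lbr x y) p = sym_act x (sym_act y p) - sym_act y (sym_act x p).
Proof.
move: p; apply: sym_derivation_ext; first exact: sym_act_linr.
- move=> a p q; rewrite !sym_act_linr scalerBr.
  by rewrite opprD addrACA.
- exact: sym_actM.
- by move=> p q; rewrite !sym_actM !raddfD /= !sym_actM; ring.
- by move=> i; rewrite !sym_actX !sym_act_in -linearB lbr_der.
Qed.

Definition symAction : lieAction g symAlg :=
  LieAction sym_act_linl sym_act_linr sym_act_lbr.

End SymmetricAlgebra.

Section C2Algebra.
Variables (K : fieldType) (g : lieAlgebra K).

(* U(g) o v is the smallest g-stable subspace containing v, since the algebra
   U(g) is generated by g. *)
Inductive Uorbit (v : symAlg g) : symAlg g -> Prop :=
| Uorbit_base : Uorbit v v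
| Uorbit_act x p : Uorbit v p -> Uorbit v (symAction g x p)
| Uorbit_lin a p q : Uorbit v p -> Uorbit v q -> Uorbit v (a *: p + q).

Inductive idealGen (P : symAlg g -> Prop) : symAlg g -> Prop :=
| idealGen0 : idealGen P 0
| idealGenD r p q : P p -> idealGen P q -> idealGen P (r * p + q).

Definition C2_relations (e : g) (k : nat) : symAlg g -> Prop :=
  idealGen (Uorbit (sym_in e ^+ k.+1)).

Fact C2_relations_lin e k a p q :
  C2_relations e k p -> C2_relations e k q -> C2_relations e k (a *: p + q).
Proof.
move=> Ip Iq; elim: Ip => [|r s t Us _ IH]; first by rewrite scaler0 add0r.
by rewrite scalerDr -addrA scalerAl; exact: idealGenD.
Qed.

Definition C2_ideal e k : subspace (symAlg g) :=
  Subspace (idealGen0 _) (@C2_relations_lin e k).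

Fact C2_ideal_stable e k x p : C2_ideal e k p -> C2_ideal e k (symAction g x p).
Proof.
elim=> [|r s t Us _ IH]; first by rewrite linear0; exact: idealGen0.
rewrite linearD /= sym_actM -addrA; apply: idealGenD => //.
by apply: idealGenD => //; exact: (Uorbit_act x).
Qed.

Definition C2_algebra (e : g) (k : nat) := lquot (C2_ideal e k).
HB.instance Definition _ e k := GRing.Lmodule.on (C2_algebra e k).

Definition C2_action (e : g) (k : nat) : lieAction g (C2_algebra e k) :=
  quotientAction (@C2_ideal_stable e k).

End C2Algebra.

Section ModuleConstructions.
Variables (K : fieldType) (g : lieAlgebra K).

Definition dual_mod (V : vectType K) := 'Hom(V, K^o).
HB.instance Definition _ V := Vector.on (dual_mod V).

Section Dual.
Variables (V : vectType K) (rho : lieAction g V).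

Definition dual_act (x : g) (f : dual_mod V) : dual_mod V :=
  linfun (fun v => - (f (rho x v) : K^o)).

Fact dual_fun_linear x (f : dual_mod V) : linear (fun v => - (f (rho x v) : K^o)).
Proof. by move=> a u v; rewrite lact_linr linearP /= opprD scalerN. Qed.

Lemma dual_actE x f v : dual_act x f v = - (f (rho x v)).
Proof.
pose F := GRing.isLinear.Build K V K^o _ _ (dual_fun_linear x f).
pose h : {linear V -> K^o} := HB.pack (fun v => - (f (rho x v) : K^o)) F.
exact: (lfunE h v).
Qed.

Fact dual_act_linl f : linear (dual_act^~ f).
Proof.
move=> a x y; apply/lfunP => v; rewrite add_lfunE scale_lfunE !dual_actE.
by rewrite lact_linl linearP opprD scalerN.
Qed.

Fact dual_act_linr x : linear (dual_act x).
Proof.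
move=> a f h; apply/lfunP => v; rewrite add_lfunE scale_lfunE !dual_actE.
by rewrite add_lfunE scale_lfunE opprD scalerN.
Qed.

Fact dual_act_lbr x y f :
  dual_act (lbr x y) f =
  dual_act x (dual_act y f) - dual_act y (dual_act x f).
Proof.
apply/lfunP => v; rewrite add_lfunE opp_lfunE !dual_actE lact_lbr linearB /=.
by rewrite !opprB !opprK addrC.
Qed.

Definition dualAction : lieAction g (dual_mod V) :=
  LieAction dual_act_linl dual_act_linr dual_act_lbr.

End Dual.

(* T : tens_mod V W stands for \sum_(i, j) T i j *: (b_i (x) c_j), where b and c
   are the fixed bases of V and W. *)
Definition tens_mod (V W : vectType K) := 'M[K]_(\dim {:V}, \dim {:W}).
HB.instance Definition _ V W := Vector.on (tens_mod V W).

Section Tensor.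
Variables (V W : vectType K).

Definition pure_tens (v : V) (w : W) : tens_mod V W :=
  \matrix_(i, j) (coord (vbasis {:V}) i v * coord (vbasis {:W}) j w).

Fact pure_tens_linl w : linear (pure_tens^~ w).
Proof. by move=> a u v; apply/matrixP => i j; rewrite !mxE linearP mulrDl mulrA. Qed.

Fact pure_tens_linr v : linear (pure_tens v).
Proof.
by move=> a u w; apply/matrixP => i j; rewrite !mxE linearP mulrDr mulrCA.
Qed.

Lemma pure_tensZl a v w : pure_tens (a *: v) w = a *: pure_tens v w.
Proof. by apply/matrixP => i j; rewrite !mxE linearZ /= mulrA. Qed.

Lemma pure_tensBl u v w : pure_tens (u - v) w = pure_tens u w - pure_tens v w.
Proof. by apply/matrixP => i j; rewrite !mxE linearB /= mulrBl. Qed.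

Lemma pure_tens_suml n (u : 'I_n -> V) w :
  pure_tens (\sum_i u i) w = \sum_i pure_tens (u i) w.
Proof.
apply/matrixP => i j; rewrite mxE linear_sum summxE mulr_suml.
by apply: eq_bigr => l _; rewrite mxE.
Qed.

Lemma pure_tens_basis (i : 'I_(\dim {:V})) (j : 'I_(\dim {:W})) :
  pure_tens (vbasis {:V})`_i (vbasis {:W})`_j = delta_mx i j.
Proof.
apply/matrixP => i' j'.
rewrite !mxE !coord_free ?(basis_free (vbasisP _)) // -natrM mulnb.
by rewrite [i == _]eq_sym [j == _]eq_sym.
Qed.

Variables (rho : lieAction g V) (sigma : lieAction g W).

Definition tens_act (x : g) (T : tens_mod V W) : tens_mod V W :=
  \sum_i \sum_j T i j *:
    (pure_tens (rho x (vbasis {:V})`_i) (vbasis {:W})`_j +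
     pure_tens (vbasis {:V})`_i (sigma x (vbasis {:W})`_j)).

Fact tens_act_linl T : linear (tens_act^~ T).
Proof.
move=> a x y; rewrite /tens_act scaler_sumr -big_split /=; apply: eq_bigr => i _.
rewrite scaler_sumr -big_split /=; apply: eq_bigr => j _.
rewrite !lact_linl pure_tens_linl pure_tens_linr addrACA.
rewrite scalerDr; congr (_ + _); by rewrite -scalerDr !scalerA [a * _]mulrC.
Qed.

Fact tens_act_linr x : linear (tens_act x).
Proof.
move=> a S T; rewrite /tens_act scaler_sumr -big_split /=; apply: eq_bigr => i _.
rewrite scaler_sumr -big_split /=; apply: eq_bigr => j _.
by rewrite !mxE scalerDl scalerA.
Qed.

HB.instance Definition _ x :=
  GRing.isLinear.Build K (tens_mod V W) (tens_mod V W) _ (tens_act x) (tens_act_linr x).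
HB.instance Definition _ v :=
  GRing.isLinear.Build K W (tens_mod V W) _ (pure_tens v) (pure_tens_linr v).

Lemma tens_pure_sum (T : tens_mod V W) :
  T = \sum_i \sum_j T i j *: pure_tens (vbasis {:V})`_i (vbasis {:W})`_j.
Proof.
rewrite [LHS]matrix_sum_delta; apply: eq_bigr => i _; apply: eq_bigr => j _.
by rewrite pure_tens_basis.
Qed.

Lemma tens_lin_ext (D1 D2 : tens_mod V W -> tens_mod V W) :
  linear D1 -> linear D2 ->
  (forall v w, D1 (pure_tens v w) = D2 (pure_tens v w)) -> D1 =1 D2.
Proof.
move=> l1 l2 e T.
pose F1 : {linear tens_mod V W -> tens_mod V W} :=
  HB.pack D1 (GRing.isLinear.Build K _ _ _ D1 l1).
pose F2 : {linear tens_mod V W -> tens_mod V W} :=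
  HB.pack D2 (GRing.isLinear.Build K _ _ _ D2 l2).
rewrite (tens_pure_sum T) -[D1]/(F1 : _ -> _) -[D2]/(F2 : _ -> _).
rewrite !linear_sum; apply: eq_bigr => i _.
rewrite !linear_sum; apply: eq_bigr => j _.
by rewrite !linearZ /= e.
Qed.

Lemma pure_tens_sum (f : {linear V -> V}) (h : {linear W -> W}) v w :
  pure_tens (f v) (h w) = \sum_i \sum_j
    (coord (vbasis {:V}) i v * coord (vbasis {:W}) j w) *:
      pure_tens (f (vbasis {:V})`_i) (h (vbasis {:W})`_j).
Proof.
rewrite {1}(coord_vbasis (memvf v)) {1}(coord_vbasis (memvf w)).
rewrite (linear_sum f) pure_tens_suml; apply: eq_bigr => i _.
rewrite (linear_sum h) linear_sum; apply: eq_bigr => j _ /=.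
by rewrite !linearZ /= pure_tensZl scalerA mulrC.
Qed.

Lemma tens_act_pure x v w :
  tens_act x (pure_tens v w) = pure_tens (rho x v) w + pure_tens v (sigma x w).
Proof.
rewrite (pure_tens_sum (rho x) idfun) (pure_tens_sum idfun (sigma x)).
rewrite -big_split; apply: eq_bigr => i _.
rewrite -big_split; apply: eq_bigr => j _.
by rewrite mxE scalerDr.
Qed.

Fact tens_act_lbr x y T :
  tens_act (lbr x y) T =
  tens_act x (tens_act y T) - tens_act y (tens_act x T).
Proof.
move: T; apply: tens_lin_ext => [||v w]; first exact: tens_act_linr.
  by move=> a S T; rewrite !tens_act_linr scalerBr opprD addrACA.
rewrite !tens_act_pure !raddfD /= !tens_act_pure !lact_lbr pure_tensBl linearB /=.
set A := pure_tens _ _; set B := pure_tens _ _; set C := pure_tens _ _.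
set D := pure_tens _ _; set E := pure_tens _ _; set F := pure_tens _ _.
move: A B C D E F => A B C D E F; apply/matrixP => i j; rewrite !mxE; ring.
Qed.

Definition tensAction : lieAction g (tens_mod V W) :=
  LieAction tens_act_linl tens_act_linr tens_act_lbr.

End Tensor.

End ModuleConstructions.

Section DirectSum.
Variables (K : fieldType) (I : finType) (V : I -> lmodType K).

Definition dsum := {dffun forall i, V i}.
HB.instance Definition _ := Choice.on dsum.
Implicit Types u v w : dsum.

Definition dsum0 : dsum := [ffun i => 0 : V i].
Definition dsum_opp u : dsum := [ffun i => - u i].
Definition dsum_add u v : dsum := [ffun i => u i + v i].
Definition dsum_scale (a : K) u : dsum := [ffun i => a *: u i].

Fact dsum_addA : associative dsum_add.
Proof. by move=> u v w; apply/ffunP => i; rewrite !ffunE addrA. Qed.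
Fact dsum_addC : commutative dsum_add.
Proof. by move=> u v; apply/ffunP => i; rewrite !ffunE addrC. Qed.
Fact dsum_add0 : left_id dsum0 dsum_add.
Proof. by move=> u; apply/ffunP => i; rewrite !ffunE add0r. Qed.
Fact dsum_addN : left_inverse dsum0 dsum_opp dsum_add.
Proof. by move=> u; apply/ffunP => i; rewrite !ffunE addNr. Qed.

HB.instance Definition _ :=
  GRing.isZmodule.Build dsum dsum_addA dsum_addC dsum_add0 dsum_addN.

Fact dsum_scaleA a b u : dsum_scale a (dsum_scale b u) = dsum_scale (a * b) u.
Proof. by apply/ffunP => i; rewrite !ffunE scalerA. Qed.
Fact dsum_scale1 : left_id 1 dsum_scale.
Proof. by move=> u; apply/ffunP => i; rewrite !ffunE scale1r. Qed.
Fact dsum_scaleDr : right_distributive dsum_scale +%R.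
Proof. by move=> a u v; apply/ffunP => i; rewrite !ffunE scalerDr. Qed.
Fact dsum_scaleDl u : {morph dsum_scale^~ u : a b / a + b}.
Proof. by move=> a b; apply/ffunP => i; rewrite !ffunE scalerDl. Qed.

HB.instance Definition _ := GRing.Zmodule_isLmodule.Build K dsum
  dsum_scaleA dsum_scale1 dsum_scaleDr dsum_scaleDl.

Variables (g : lieAlgebra K) (rho : forall i, lieAction g (V i)).

Definition dsum_act (x : g) (u : dsum) : dsum := [ffun i => rho i x (u i)].

Fact dsum_act_linl u : linear (dsum_act^~ u).
Proof. by move=> a x y; apply/ffunP => i; rewrite !ffunE lact_linl. Qed.
Fact dsum_act_linr x : linear (dsum_act x).
Proof. by move=> a u v; apply/ffunP => i; rewrite !ffunE lact_linr. Qed.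
Fact dsum_act_lbr x y u :
  dsum_act (lbr x y) u = dsum_act x (dsum_act y u) - dsum_act y (dsum_act x u).
Proof. by apply/ffunP => i; rewrite !ffunE lact_lbr. Qed.

Definition dsumAction : lieAction g dsum :=
  LieAction dsum_act_linl dsum_act_linr dsum_act_lbr.

End DirectSum.

Section OddOrthogonal.
Variables (K : fieldType) (m : nat).
Let N := m.*2.+1.

(* Split symmetric form on K^(2m+1): <e_i, e_j> = 1 if i + j = 2m, else 0. *)
Definition so_form : 'M[K]_N := \matrix_(i, j) (j == rev_ord i)%:R.

Definition so_defect (X : 'M[K]_N) : 'M[K]_N := X^T *m so_form + so_form *m X.

Fact so_defect_linear : linear so_defect.
Proof.
move=> a X Y; rewrite /so_defect linearP /= mulmxDl mulmxDr -scalemxAl -scalemxAr.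
by rewrite addrACA -scalerDr.
Qed.
HB.instance Definition _ :=
  GRing.isLinear.Build K 'M[K]_N 'M[K]_N _ so_defect so_defect_linear.

Definition so_space : {vspace 'M[K]_N} := lker (linfun so_defect).

Lemma so_spaceP X : reflect (X^T *m so_form + so_form *m X = 0) (X \in so_space).
Proof. by rewrite memv_ker lfunE; apply: eqP. Qed.

Fact so_space_lbr X Y :
  X \in so_space -> Y \in so_space -> X *m Y - Y *m X \in so_space.
Proof.
move=> /so_spaceP/eqP; rewrite addr_eq0 => /eqP sX.
move=> /so_spaceP/eqP; rewrite addr_eq0 => /eqP sY; apply/so_spaceP.
have e (A B : 'M[K]_N) : A^T *m so_form = - (so_form *m A) ->
    B^T *m so_form = - (so_form *m B) -> (A *m B)^T *m so_form = so_form *m (B *m A).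
  by move=> sA sB; rewrite trmx_mul -mulmxA sA mulmxN [B^T *m _]mulmxA sB mulNmx opprK mulmxA.
by rewrite linearB /= mulmxBl mulmxBr !e // addrC subrKA subrr.
Qed.

Definition so_type := subvs_of so_space.
HB.instance Definition _ := Vector.on so_type.

Definition so_lbr (x y : so_type) : so_type :=
  Subvs (so_space_lbr (valP x) (valP y)).

Fact so_lbr_linl y : linear (so_lbr^~ y).
Proof.
move=> a x z; apply: val_inj; rewrite [RHS]linearP [LHS]/= linearP /=.
by rewrite ?(mulmxDl, mulmxDr) -?scalemxAl -?scalemxAr scalerBr opprD addrACA.
Qed.

Fact so_lbr_linr x : linear (so_lbr x).
Proof.
move=> a y z; apply: val_inj; rewrite [RHS]linearP [LHS]/= linearP /=.
by rewrite ?(mulmxDl, mulmxDr) -?scalemxAl -?scalemxAr scalerBr opprD addrACA.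
Qed.

Fact so_lbrxx x : so_lbr x x = 0.
Proof. by apply: val_inj; rewrite /= subrr. Qed.

Fact so_lbrJ x y z :
  so_lbr x (so_lbr y z) + so_lbr y (so_lbr z x) + so_lbr z (so_lbr x y) = 0.
Proof.
apply: val_inj; rewrite /= !mulmxBr !mulmxBl !mulmxA.
set A := val x *m val y *m val z; set B := val x *m val z *m val y.
set C := val y *m val x *m val z; set D := val y *m val z *m val x.
set E := val z *m val x *m val y; set F := val z *m val y *m val x.
by move: A B C D E F => A B C D E F; apply/matrixP => i j; rewrite !mxE; ring.
Qed.

Definition so : lieAlgebra K :=
  LieAlgebra so_lbr_linl so_lbr_linr so_lbrxx so_lbrJ.

Implicit Types (alpha beta lambda : 'rV[K]_m) (h x : so).

(* Cartan subalgebra: the diagonal matrices diag(t_1, .., t_m, 0, -t_m, .., -t_1)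
   of so. *)
Definition in_cartan h := is_diag_mx (val h).

(* A weight \sum_i lambda_i epsilon_i is the row vector of the lambda_i, where
   epsilon_i is the coordinate t_i on the Cartan subalgebra. *)
Definition weight_eval lambda h : K :=
  \sum_(i < m) lambda 0 i * val h (inord i) (inord i).

Definition root_vector alpha x :=
  [/\ alpha != 0, x != 0 &
      forall h, in_cartan h -> lbr h x = weight_eval alpha h *: x].

Definition is_root alpha := exists x, root_vector alpha x.

Definition eps_weight (i : nat) : 'rV[K]_m := \row_(j < m) (j == i :> nat)%:R.

(* eps_weight m = 0, so the last simple root is epsilon_m (short). *)
Definition simple_root (i : 'I_m) : 'rV[K]_m := eps_weight i - eps_weight i.+1.

Definition dominance_le alpha beta :=
  exists c : 'I_m -> nat, beta = alpha + \sum_(i < m) simple_root i *+ c i.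

Definition positive_root alpha := is_root alpha /\ dominance_le 0 alpha.

Definition highest_root alpha :=
  is_root alpha /\ forall beta, is_root beta -> dominance_le beta alpha.

Definition highest_root_vector x :=
  exists2 alpha, highest_root alpha & root_vector alpha x.

Definition highest_weight_vector (V : lmodType K) (rho : lieAction so V)
    lambda (v : V) :=
  [/\ v != 0,
      forall h, in_cartan h -> rho h v = weight_eval lambda h *: v &
      forall alpha x, positive_root alpha -> root_vector alpha x -> rho x v = 0].

Definition irreducible_of_highest_weight (V : vectType K)
    (rho : lieAction so V) lambda :=
  is_irreducible rho /\ exists v, highest_weight_vector rho lambda v.

Definition fundamental_weight (i : 'I_m) : 'rV[K]_m :=
  if i.+1 == m then \row_(j < m) 2^-1 else \row_(j < m) (j <= i)%N%:R.

End OddOrthogonal.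

(* The tuples (a_1, .., a_m), m = n + 1, stored as a 0, .., a n with
   a_m = a ord_max; the inequality forces a_i <= k, so that bounding the a_i by
   k in the type loses nothing. *)
Definition admissible (n k : nat) (a : {ffun 'I_n.+1 -> 'I_k.+1}) : bool :=
  (\sum_(i < n.+1 | i != ord_max) 2 * a i + a ord_max <= k)%N &&
  (k == a ord_max %[mod 2])%N.

Definition admissible_index (n k : nat) :=
  {a : {ffun 'I_n.+1 -> 'I_k.+1} | admissible a}.
HB.instance Definition _ n k := Finite.on (admissible_index n k).

Definition coefs (n k : nat) (a : admissible_index n k) : {ffun 'I_n.+1 -> nat} :=
  [ffun i => val a i : nat].

Definition weight_of (K : fieldType) (m : nat) (a : {ffun 'I_m -> nat}) :
    'rV[K]_m :=
  \sum_(i < m) fundamental_weight K i *+ a i.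

(* Main.v *)
(* Let N = 2m+1 and let G_(j,a), j < k, a < N, be k mutually anticommuting
   copies of the Clifford generators of C^N, acting on a space S. Then so acts on
   S by quadratic elements ("spin"), and S is a sum of k-fold tensor products of
   spin modules. On End S there are exterior multiplications by the G_(j,a); they
   anticommute, so bivectors x in so = Wedge^2(C^N), wedged copy by copy and
   summed over j, give commuting operators, and evaluating polynomials at them
   and applying the result to 1 gives an equivariant map S(so) -> End S. A root
   vector is a decomposable bivector, so its operator is a sum of k commuting
   square-zero operators: its (k+1)-st power vanishes and the map factors through
   the C_2-algebra. Its image is exactly the image of U(so) in End S, because
   both are generated from 1 by quadratic expressions in exterior and interior
   multiplications, and those with an interior factor map 1 to a scalar.
   Finally each admissible V(lambda) is a subquotient of S, since S contains a
   singular vector of weight lambda (a Fock state with suitable occupation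
   numbers). Hence the image of U(so) maps to the sum of the End V(lambda), and
   onto it by the density theorem. The rank one operators needed for density are
   polynomials in a regular Cartan element; complete reducibility is not used. *)

(* The index set is read off from Fock states. Copies 2p and 2p+1 of the generators together act on
   the exterior algebra of C^N, where the state with the first t modes filled, t <= m, has weight
   epsilon_1 + ... + epsilon_t: this is omega_t for 0 < t < m, 2 omega_m for t = m, and 0 for t = 0.
   If k is odd, one copy stays unpaired and contributes omega_m. So lambda is reached when a_m has
   the parity of k and a_1 + ... + a_(m-1) + floor(a_m / 2) is at most the number floor(k / 2) of
   pairs, which is the given condition. The map from S(so) to End S is only linear; multiplicative
   is its lift to operators on End S, so the relations are verified on the lift. No map between S
   and V(lambda) is ever built: it suffices that an element of U(so) killing S kills V(lambda). *)
Require Import Defs.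
From HB Require Import structures.
From mathcomp Require Import all_boot all_algebra all_field.
From mathcomp Require Import ring_quotient mpoly complex boolp reals ring zify.

Set Implicit Arguments.
Unset Strict Implicit.
Unset Printing Implicit Defensive.

Import GRing.Theory Num.Theory.
Local Open Scope ring_scope.

(** * Enveloping algebra expressions and Burnside's theorem *)

Section PredSubspace.
Variables (K : fieldType) (V : vectType K) (P : V -> Prop).
Hypotheses (P0 : P 0) (Plin : forall a u v, P u -> P v -> P (a *: u + v)).

Lemma pred_sum (I : Type) (r : seq I) (Q : pred I) (F : I -> V) :
  (forall i, Q i -> P (F i)) -> P (\sum_(i <- r | Q i) F i).
Proof.
move=> PF; apply: (big_ind P) => // u v Pu Pv.
by rewrite -[u]scale1r; apply: Plin.
Qed.

Lemma pred_scale a v : P v -> P (a *: v).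
Proof. by move=> Pv; rewrite -[a *: v]addr0; apply: Plin. Qed.

Lemma pred_add u v : P u -> P v -> P (u + v).
Proof. by move=> Pu Pv; rewrite -[u]scale1r; apply: Plin. Qed.

(** Take [U] of maximal dimension among the subspaces on which [P] holds: a vector satisfying [P]
    cannot enlarge it. This turns sets such as U(g)x into subspaces, to which irreducibility
    applies. *)
Lemma pred_vspace : exists U : {vspace V}, forall v, v \in U <-> P v.
Proof.
pose Q d := `[< exists2 U : {vspace V}, \dim U = d & {in U, forall v, P v} >].
have Q0 : exists d, Q d.
  by exists 0%N; apply/asboolP; exists 0%VS; rewrite ?dimv0 // => v; rewrite memv0 => /eqP->.
have Qb d : Q d -> (d <= \dim {:V})%N.
  by move/asboolP => [U <- _]; rewrite dimvS ?subvf.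
case: (ex_maxnP Q0 Qb) => d /asboolP[U dU PU] dmax.
exists U => v; split=> [|Pv]; first exact: PU.
have /dmax : Q (\dim (U + <[v]>)).
  apply/asboolP; exists (U + <[v]>)%VS => // w /memv_addP[u uU [w' /vlineP[a ->] ->]].
  by apply: pred_add; [apply: PU | apply: pred_scale].
rewrite -dU => dle; have /eqP -> : (U == U + <[v]>)%VS by rewrite eqEdim addvSl.
by rewrite memvE addvSr.
Qed.

End PredSubspace.

(* Expressions denoting elements of U(g). *)
Inductive uexp (K : fieldType) (g : lieAlgebra K) :=
| UC of K
| UX of g
| UAdd of uexp g & uexp g
| UMul of uexp g & uexp g.
Arguments UC {K g}.
Arguments UX {K g}.
Arguments UAdd {K g}.
Arguments UMul {K g}.

Section Evaluation.
Variables (K : fieldType) (g : lieAlgebra K).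

Fixpoint uev (V : lmodType K) (rho : lieAction g V) (u : uexp g) (v : V) : V :=
  match u with
  | UC c => c *: v
  | UX x => rho x v
  | UAdd a b => uev rho a v + uev rho b v
  | UMul a b => uev rho a (uev rho b v)
  end.

Lemma uev_lin (V : lmodType K) (rho : lieAction g V) u : linear (uev rho u).
Proof.
elim: u => [c|x|a IHa b IHb|a IHa b IHb] k v w /=.
- by rewrite scalerDr !scalerA mulrC.
- exact: lact_linr.
- by rewrite IHa IHb scalerDr addrACA.
- by rewrite IHb IHa.
Qed.
HB.instance Definition _ (V : lmodType K) (rho : lieAction g V) u :=
  GRing.isLinear.Build K V V _ (uev rho u) (uev_lin rho u).

Section RightLinearity.
Variables (V : lmodType K) (rho : lieAction g V).

Lemma lactDr x u v : rho x (u + v) = rho x u + rho x v.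
Proof. exact: linearD. Qed.
Lemma lactBr x u v : rho x (u - v) = rho x u - rho x v.
Proof. exact: linearB. Qed.
Lemma lactZr x a v : rho x (a *: v) = a *: rho x v.
Proof. exact: linearZ. Qed.
Lemma lact0r x : rho x 0 = 0.
Proof. exact: linear0. Qed.
Lemma uevD u v w : uev rho u (v + w) = uev rho u v + uev rho u w.
Proof. exact: linearD. Qed.
Lemma uevB u v w : uev rho u (v - w) = uev rho u v - uev rho u w.
Proof. exact: linearB. Qed.
Lemma uevZ u a v : uev rho u (a *: v) = a *: uev rho u v.
Proof. exact: linearZ. Qed.
Lemma uev0 u : uev rho u 0 = 0.
Proof. exact: linear0. Qed.

End RightLinearity.

Definition usum (I : finType) (F : I -> uexp g) : uexp g :=
  foldr UAdd (UC 0) (map F (enum I)).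

Lemma uev_usum (V : lmodType K) (rho : lieAction g V) (I : finType) F v :
  uev rho (@usum I F) v = \sum_i uev rho (F i) v.
Proof.
rewrite /usum -big_enum /=; elim: (enum I) => [|i r IH] /=.
  by rewrite big_nil scale0r.
by rewrite big_cons IH.
Qed.

Definition uprod (T : Type) (s : seq T) (F : T -> uexp g) : uexp g :=
  foldr UMul (UC 1) (map F s).

End Evaluation.

Section Irreducible.
Variables (K : fieldType) (g : lieAlgebra K).
Variables (V : vectType K) (rho : lieAction g V).
Hypothesis irr : is_irreducible rho.

Lemma irreducible_cyclic x y : x != 0 -> exists u, uev rho u x = y.
Proof.
move=> x0; have [| |U UP] := @pred_vspace K V (fun y => exists u, uev rho u x = y).
- by exists (UC 0); rewrite /= scale0r.
- by move=> a _ _ [u <-] [v <-]; exists (UAdd (UMul (UC a) u) v).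
have xU : x \in U by apply/UP; exists (UC 1); rewrite /= scale1r.
have [_ /(_ U)[]] := irr.
- by move=> z w /UP[u <-]; apply/UP; exists (UMul (UX z) u).
- by move=> U0; move: xU; rewrite U0 memv0 (negPf x0).
- by move=> UV; apply/UP; rewrite UV memvf.
Qed.

Definition is_burnside :=
  forall F : V -> V, linear F -> exists u, uev rho u =1 F.

(* Burnside's theorem, when U(g) contains an operator of rank one. *)
Lemma burnside_of_rank1 (v : V) (u0 : uexp g) (c : K) :
  v != 0 -> c != 0 -> uev rho u0 v = c *: v ->
  (forall y, exists a, uev rho u0 y = a *: v) -> is_burnside.
Proof.
move=> v0 c0 u0v rk1.
pose d : nat := \dim {:V}; pose b := vbasis {:V}.
have [i0 ci0] : exists i0, coord b i0 v != 0.
  apply/existsP; apply: contraR v0 => /existsPn cv.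
  rewrite (coord_vbasis (memvf v)) big1 // => i _.
  by have := cv i; rewrite negbK => /eqP->; rewrite scale0r.
(* As [u0] maps into the line of [v], each [u0 u] is [v] times a linear functional, read off at a
   coordinate where [v] is nonzero. *)
pose psi u x := coord b i0 (uev rho (UMul u0 u) x).
have psiE u x : uev rho (UMul u0 u) x = (psi u x / coord b i0 v) *: v.
  rewrite /psi /=; have [a ->] := rk1 (uev rho u x).
  by rewrite linearZ /= mulfK.
have [| |U UP] := @pred_vspace K 'rV[K]_d (fun r => exists u, forall i : 'I_d, psi u b`_i = r 0 i).
- exists (UC 0) => i.
  by rewrite /psi /= scale0r !linear0 mxE.
- move=> a r s [u ur] [w ws]; exists (UAdd (UMul (UC a) u) w) => i.
  rewrite !mxE -ur -ws /psi /=; by rewrite linearD /= linearZ /= linearP.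
pose A := \matrix_(i < \dim U) (vbasis U)`_i.
have UA r : r \in U -> (r <= A)%MS.
  move=> rU; rewrite (coord_vbasis rU); apply: summx_sub => i _.
  by apply: scalemx_sub; rewrite -[X in (X <= _)%MS](rowK (fun i : 'I_(\dim U) => (vbasis U)`_i)) row_sub.
have AU r : (r <= A)%MS -> r \in U.
  case/submxP => D ->; rewrite mulmx_sum_row; apply: memv_suml => i _.
  by rewrite rowK memvZ // vbasis_mem // mem_nth // size_tuple.
(* These functionals fill the dual: otherwise they share a zero [x != 0], but some [u] sends [x] to
   [v], on which [u0] acts by [c != 0]. *)
have full r : r \in U.
  apply: AU; rewrite submxE; apply/negPn/negP => /eqP/matrixP ne.
  apply: ne => i j; rewrite [RHS]mxE; apply/eqP/negPn/negP => ne.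
  pose x := \sum_l cokermx A l j *: b`_l.
  have x0 : x != 0.
    apply: contraNneq ne => xz; rewrite mxE big1 // => l _.
    suff -> : cokermx A l j = 0 by rewrite mulr0.
    have /freeP fb := basis_free (vbasisP {:V}).
    exact: (fb (fun l => cokermx A l j) xz l).
  have [u ux] := irreducible_cyclic v x0.
  have : (\row_(l < d) psi u b`_l) \in U by apply/UP; exists u => l; rewrite mxE.
  move/UA; rewrite submxE => /eqP/matrixP/(_ 0 j); rewrite !mxE.
  under eq_bigr do rewrite mxE.
  have <- : psi u x = \sum_(l < d) psi u b`_l * cokermx A l j.
    rewrite /psi /x !linear_sum /=; apply: eq_bigr => l _.
    by rewrite !linearZ /= mulrC.
  rewrite /psi /= ux u0v linearZ /= => /eqP.
  by rewrite mulf_eq0 (negPf c0) (negPf ci0).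
move=> F linF.
pose LF : {linear V -> V} := HB.pack F (GRing.isLinear.Build K V V _ F linF).
have /choice[t tP] (i : 'I_d) : exists t, uev rho t v = F b`_i.
  exact: irreducible_cyclic.
have /choice[s sP] (i : 'I_d) :
    exists s, forall j : 'I_d, psi s b`_j = (j == i)%:R * coord b i0 v.
  have /UP[s sP] := full (\row_(j < d) ((j == i)%:R * coord b i0 v)).
  by exists s => j; rewrite sP mxE.
(* [u0 s_i] is the [i]-th coordinate times [v], and [t_i] sends [v] to the prescribed image of the
   [i]-th basis vector. *)
exists (usum (fun i => UMul (t i) (UMul u0 (s i)))) => x.
rewrite (coord_vbasis (memvf x)) linear_sum -[F _]/(LF _) linear_sum.
apply: eq_bigr => j _; rewrite !linearZ /=; congr (_ *: _).
rewrite uev_usum (bigD1 j) //= big1 => [|i ij].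
  rewrite addr0 -[uev rho u0 _]/(uev rho (UMul u0 (s j)) _) psiE sP eqxx mul1r.
  by rewrite divff // scale1r tP.
rewrite -[uev rho u0 _]/(uev rho (UMul u0 (s i)) _) psiE sP eq_sym (negPf ij).
by rewrite !mul0r scale0r linear0.
Qed.

End Irreducible.

Section Ideals.
Variables (K : fieldType) (g : lieAlgebra K).
Variables (V : vectType K) (rho : lieAction g V).
Variables (W : lmodType K) (sigma : lieAction g W).
Hypotheses (irr : is_irreducible rho) (brn : is_burnside rho).

(** End V is simple, so the two-sided ideal generated by [u] contains an element acting as 1 on V,
    and the whole ideal still kills W. *)
Lemma burnside_ideal u : (forall w, uev sigma u w = 0) ->
  ~ (forall v, uev rho u v = 0) ->
  exists2 u', (forall w, uev sigma u' w = 0) & (forall v, uev rho u' v = v).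
Proof.
move=> u0 /existsNP[x /eqP ux].
pose d : nat := \dim {:V}; pose b := vbasis {:V}.
have /choice[t tP] (i : 'I_d) : exists t, uev rho t (uev rho u x) = b`_i.
  exact: (irreducible_cyclic irr).
have /choice[s sP] (i : 'I_d) : exists s, uev rho s =1 (fun y => coord b i y *: x).
  by apply: brn => a y z; rewrite linearP /= scalerDl scalerA.
exists (usum (fun i => UMul (t i) (UMul u (s i)))) => [w|v]; rewrite uev_usum /=.
  by rewrite big1 // => i _; rewrite u0 linear0.
rewrite {2}(coord_vbasis (memvf v)); apply: eq_bigr => i _.
by rewrite sP !linearZ /= tP.
Qed.

End Ideals.

(** * Highest weight vectors of so *)

Section SoElements.
Variables (K : fieldType) (m : nat).
Local Notation N := m.*2.+1.
Local Notation g := (so K m).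
Implicit Types (X : 'M[K]_N) (i j a b : 'I_N).

Lemma so_formE X i j :
  (X^T *m so_form K m + so_form K m *m X) i j = X (rev_ord j) i + X (rev_ord i) j.
Proof.
rewrite !mxE (bigD1 (rev_ord j)) //= big1 => [|l lj]; last first.
  rewrite !mxE; case: eqP => [jl|]; last by rewrite mulr0.
  by rewrite jl rev_ordK eqxx in lj.
rewrite (bigD1 (rev_ord i)) //= big1 => [|l lj].
  by rewrite !mxE rev_ordK !eqxx mulr1 mul1r !addr0.
by rewrite !mxE (negPf lj) mul0r.
Qed.

Lemma so_memP X : reflect (forall a b, X a b = - X (rev_ord b) (rev_ord a)) (X \in so_space K m).
Proof.
apply: (iffP (so_spaceP X)) => [/matrixP e a b|e].
  have := e (rev_ord a) b; rewrite so_formE rev_ordK mxE => /eqP.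
  by rewrite addrC addr_eq0 => /eqP.
apply/matrixP => i j; rewrite so_formE mxE (e _ i) rev_ordK.
by rewrite addNr.
Qed.

Lemma so_entry (x : g) a b : val x (rev_ord b) (rev_ord a) = - val x a b.
Proof. by have /so_memP/(_ a b) -> := valP x; rewrite opprK. Qed.

Lemma so_mtx_eq (x y : g) : (forall a b, val x a b = val y a b) -> x = y.
Proof. by move=> e; apply: val_inj; apply/matrixP. Qed.

Fact so_unit_subproof a b :
  delta_mx a b - delta_mx (rev_ord b) (rev_ord a) \in so_space K m.
Proof.
apply/so_memP => i j; rewrite !mxE opprB.
rewrite !(inj_eq rev_ord_inj) !(can2_eq rev_ordK rev_ordK).
by rewrite [(j == b) && _]andbC [(j == rev_ord a) && _]andbC.
Qed.

(** For [a < b] a positive root vector, or 0 when a + b = 2m; for [a = b] a Cartan element. *)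
Definition so_unit a b : g := Subvs (so_unit_subproof a b).

Lemma so_unitE a b i j : val (so_unit a b) i j =
  ((i == a) && (j == b))%:R - ((i == rev_ord b) && (j == rev_ord a))%:R.
Proof. by rewrite /= !mxE. Qed.

Lemma valD (x y : g) a b : val (x + y) a b = val x a b + val y a b.
Proof. by rewrite linearD mxE. Qed.
Lemma valZ c (x : g) a b : val (c *: x) a b = c * val x a b.
Proof. by rewrite linearZ mxE. Qed.
Lemma so_cartan_lbr (h x : g) a b : in_cartan h ->
  val (lbr h x) a b = (val h a a - val h b b) * val x a b.
Proof.
move=> /is_diag_mxP dh; rewrite /= !mxE (bigD1 a) //= big1 => [|l la]; last first.
  by rewrite dh ?mul0r // eq_sym.
rewrite (bigD1 b) //= big1 => [|l lb]; last by rewrite dh ?mulr0.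
by rewrite !addr0 mulrBl [val x a b * _]mulrC.
Qed.

Lemma lbr_cartan_unit (h : g) a b : in_cartan h ->
  lbr h (so_unit a b) = (val h a a - val h b b) *: so_unit a b.
Proof.
move=> hh; apply: so_mtx_eq => i j; rewrite so_cartan_lbr // valZ so_unitE.
case: (boolP (_ && _)) => [/andP[/eqP-> /eqP->]//|_].
case: (boolP (_ && _)) => [/andP[/eqP-> /eqP->]|_]; last by rewrite subrr !mulr0.
by rewrite !so_entry -opprD addrC [- _ + _]addrC opprB.
Qed.

End SoElements.

Section Decomposition.
Variables (K : numFieldType) (m : nat).
Local Notation N := m.*2.+1.
Local Notation g := (so K m).

(** Halved because passing from (a, b) to (rev b, rev a) changes the sign of both the entry and the
    unit, so every term occurs twice. *)
Lemma so_decomp (x : g) :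
  x = \sum_a \sum_b (val x a b / 2) *: so_unit K a b.
Proof.
apply: val_inj; rewrite linear_sum /= [LHS]matrix_sum_delta.
under eq_bigr => a _ do rewrite linear_sum.
under [in RHS]eq_bigr => a _ do under eq_bigr => b _ do
  rewrite linearZ /= scalerBr.
under [in RHS]eq_bigr => a _ do rewrite sumrB.
rewrite sumrB [X in _ - X]exchange_big /=.
rewrite [X in _ - X](reindex_inj rev_ord_inj) /=.
under [X in _ - X]eq_bigr => a _ do rewrite (reindex_inj rev_ord_inj) /=.
rewrite -sumrB; apply: eq_bigr => a _; rewrite -sumrB; apply: eq_bigr => b _.
rewrite !rev_ordK so_entry mulNr scaleNr opprK -scalerDl -mulrDl.
have half (y : K) : y = (y + y) / 2.
  by rewrite -mulr2n -[y *+ 2]mulr_natr mulfK // pnatr_eq0.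
by congr (_ *: _); exact: half.
Qed.

Variables (Y : lmodType K) (rho : lieAction g Y) (z : Y) (h : g) (c : K).
Hypotheses (z_cartan : forall h', in_cartan h' -> exists a, rho h' z = a *: z)
  (z_pos : forall a b : 'I_N, (a < b)%N -> rho (so_unit K a b) z = 0).
Hypotheses (hh : in_cartan h) (hz : rho h z = c *: z)
  (h_reg : forall a b : 'I_N, (a < b)%N ->
     exists s, val h a a = val h b b + s.+1%:R).

Lemma unit_cartan a : in_cartan (so_unit K a a : g).
Proof.
apply/is_diag_mxP => i j ij; rewrite so_unitE.
have off e : (i == e) && (j == e) = false.
  by apply: contraNF ij => /andP[/eqP-> /eqP->].
by rewrite !off subrr.
Qed.

Inductive lowering_span : Y -> Prop :=
| LS_gen : lowering_span z
| LS_lin a u v : lowering_span u -> lowering_span v -> lowering_span (a *: u + v)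
| LS_act (a b : 'I_N) u : (b < a)%N -> lowering_span u ->
    lowering_span (rho (so_unit K a b) u).

Lemma LS0 : lowering_span 0.
Proof. by have := LS_lin (-1) LS_gen LS_gen; rewrite scaleN1r addNr. Qed.

Lemma LS_scale a u : lowering_span u -> lowering_span (a *: u).
Proof. by move=> Lu; have := LS_lin a Lu LS0; rewrite addr0. Qed.

Lemma LS_sum (I : finType) (F : I -> Y) :
  (forall i, lowering_span (F i)) -> lowering_span (\sum_i F i).
Proof.
move=> LF; apply: (big_ind lowering_span) => [|u v Lu Lv|//]; first exact: LS0.
by rewrite -[u]scale1r; apply: LS_lin.
Qed.

Lemma lact_suml (I : finType) (F : I -> g) y :
  rho (\sum_i F i) y = \sum_i rho (F i) y.
Proof.
by apply: (big_morph (fun x => rho x y)) => [u v|]; rewrite ?lactDl ?lact0l.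
Qed.

(** U(n^-)z is so-stable, without PBW: moving [x] past a lowering operator leaves a bracket, again
    in so, and the induction hypothesis covers every element of so. *)
Lemma lowering_span_act x u : lowering_span u -> lowering_span (rho x u).
Proof.
move=> Lu; elim: Lu x => [|a v w _ IHv _ IHw|a b v ab Lv IHv] x.
- rewrite [x]so_decomp lact_suml; apply: LS_sum => a.
  rewrite lact_suml; apply: LS_sum => b; rewrite lactZl; apply: LS_scale.
  case: (ltngtP a b) => [ab|ba|/ord_inj ->]; first by rewrite z_pos //; exact: LS0.
    by apply: LS_act => //; exact: LS_gen.
  by have [e ->] := z_cartan (unit_cartan b); apply/LS_scale/LS_gen.
- by rewrite lact_linr; apply: LS_lin.
- rewrite -[rho x _](subrK (rho (so_unit K a b) (rho x v))) -lact_lbr.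
  rewrite -[X in X + _]scale1r; apply: LS_lin; first exact: IHv.
  exact: LS_act.
Qed.

Lemma lowering_span_uev u y : lowering_span y -> lowering_span (uev rho u y).
Proof.
elim: u y => [e|x|v IHv w IHw|v IHv w IHw] y Ly /=.
- exact: LS_scale.
- exact: lowering_span_act.
- by rewrite -[uev rho v y]scale1r; apply: LS_lin; [apply: IHv | apply: IHw].
- by apply/IHv/IHw.
Qed.

End Decomposition.

(** * Polynomials in a Cartan element *)

Section ShiftProducts.
Variables (K : fieldType) (g : lieAlgebra K) (h : g).

(** A polynomial in [h] with prescribed roots, used in place of projections to weight spaces. *)
Definition shift_prod (rs : seq K) : uexp g :=
  uprod rs (fun e => UAdd (UX h) (UC (- e))).

Variables (Y : lmodType K) (rho : lieAction g Y).

Lemma shift_prod_nil y : uev rho (shift_prod [::]) y = y.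
Proof. exact: scale1r. Qed.

Lemma shift_prod_cons e rs y : uev rho (shift_prod (e :: rs)) y =
  rho h (uev rho (shift_prod rs) y) - e *: uev rho (shift_prod rs) y.
Proof. by rewrite /= scaleNr. Qed.

Lemma shift_prod_cat rs1 rs2 y : uev rho (shift_prod (rs1 ++ rs2)) y =
  uev rho (shift_prod rs1) (uev rho (shift_prod rs2) y).
Proof.
elim: rs1 => [|e rs1 IH]; first by rewrite shift_prod_nil.
by rewrite cat_cons !shift_prod_cons IH.
Qed.

Lemma shift_prod_act rs y :
  uev rho (shift_prod rs) (rho h y) = rho h (uev rho (shift_prod rs) y).
Proof.
elim: rs => [|e rs IH]; first by rewrite !shift_prod_nil.
by rewrite !shift_prod_cons IH lactBr lactZr.
Qed.

Lemma shift_prodC rs1 rs2 y :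
  uev rho (shift_prod rs1) (uev rho (shift_prod rs2) y) =
  uev rho (shift_prod rs2) (uev rho (shift_prod rs1) y).
Proof.
elim: rs1 => [|e rs1 IH]; first by rewrite !shift_prod_nil.
by rewrite !shift_prod_cons IH uevB uevZ shift_prod_act.
Qed.

Lemma shift_prod_killl rs1 rs2 y : uev rho (shift_prod rs1) y = 0 ->
  uev rho (shift_prod (rs1 ++ rs2)) y = 0.
Proof. by move=> k; rewrite shift_prod_cat shift_prodC k uev0. Qed.

Lemma shift_prod_killr rs1 rs2 y : uev rho (shift_prod rs2) y = 0 ->
  uev rho (shift_prod (rs1 ++ rs2)) y = 0.
Proof. by move=> k; rewrite shift_prod_cat k uev0. Qed.

Lemma shift_prod_eigen rs c y : rho h y = c *: y ->
  uev rho (shift_prod rs) y = (\prod_(e <- rs) (c - e)) *: y.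
Proof.
move=> hy; elim: rs => [|e rs IH]; first by rewrite shift_prod_nil big_nil scale1r.
by rewrite shift_prod_cons IH big_cons lactZr hy !scalerA -scalerBl mulrBl mulrC.
Qed.

Lemma shift_prod_ladder rs (x : g) s y : lbr h x = - s *: x ->
  uev rho (shift_prod [seq e - s | e <- rs]) (rho x y) =
  rho x (uev rho (shift_prod rs) y).
Proof.
move=> hx; elim: rs => [|e rs IH]; first by rewrite !shift_prod_nil.
rewrite map_cons !shift_prod_cons IH.
set w := uev _ _ _; have := lact_lbr rho h x w; rewrite hx lactZl => e1.
have -> : rho h (rho x w) = - s *: rho x w + rho x (rho h w) by rewrite e1 subrK.
by rewrite lactBr lactZr scalerBl opprB scaleNr addrACA addNr add0r.
Qed.

Definition below (c : K) (rs : seq K) :=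
  forall e, e \in rs -> exists j, e = c - j.+1%:R.

Lemma below_cat c rs1 rs2 : below c rs1 -> below c rs2 -> below c (rs1 ++ rs2).
Proof. by move=> b1 b2 e; rewrite mem_cat => /orP[/b1|/b2]. Qed.

Lemma below_prod_neq0 c rs d : below c rs -> (forall j, d != c - j.+1%:R) ->
  \prod_(e <- rs) (d - e) != 0.
Proof.
move=> b ne; rewrite prodf_seq_neq0; apply/allP => e ers /=.
by have [j ->] := b e ers; rewrite subr_eq0.
Qed.

End ShiftProducts.

Section HighestWeight.
Variables (K : numFieldType) (m : nat).
Local Notation N := m.*2.+1.
Local Notation g := (so K m).

(** Positive integer gaps make every lowering operator decrease the [h]-eigenvalue by a positive
    integer, so lowered vectors never return to the eigenvalue of a singular vector. *)
Definition regular_cartan (h : g) :=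
  in_cartan h /\
  forall a b : 'I_N, (a < b)%N -> exists s, val h a a = val h b b + s.+1%:R.

Definition singular_vector (Y : lmodType K) (rho : lieAction g Y) (z : Y) :=
  (forall h, in_cartan h -> exists a, rho h z = a *: z) /\
  (forall a b : 'I_N, (a < b)%N -> rho (so_unit K a b) z = 0).

Lemma neq_below (c : K) j : c != c - j.+1%:R.
Proof. by rewrite -subr_eq0 opprB addrC subrK pnatr_eq0. Qed.

(** In U(n^-)z only the multiples of [z] have [h]-eigenvalue [c]. On the remainder the eigenvalues
    lie below [c], and [rs] collects them as roots of an annihilating polynomial. *)
Lemma singular_vector_low (Y : lmodType K) (rho : lieAction g Y) (z : Y) (h : g) c u :
  singular_vector rho z -> regular_cartan h -> rho h z = c *: z ->
  exists a rs, below c rs /\ uev rho (shift_prod h rs) (uev rho u z - a *: z) = 0.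
Proof.
move=> [zc zp] [hh hr] hz.
have := lowering_span_uev zc zp u (LS_gen rho z).
elim => [|a v w _ [av [rv [bv kv]]] _ [aw [rw [bw kw]]]|a b v ba _ [av [rv [bv kv]]]].
- by exists 1, [::]; rewrite scale1r subrr uev0.
- exists (a * av + aw), (rv ++ rw); split; first exact: below_cat.
  rewrite scalerDl -scalerA opprD addrACA -scalerBr uevD uevZ.
  by rewrite shift_prod_killl // shift_prod_killr // scaler0 addr0.
- have [s hs] := hr b a ba.
  (* The roots for the remainder move down with the lowering operator; the extra root accounts for
     the image of the component along [z]. *)
  exists 0, ([seq e - s.+1%:R | e <- rv] ++ [:: c - s.+1%:R]); split.
    apply: below_cat => e; last by rewrite inE => /eqP ->; exists s.
    move=> /mapP[e' /bv[j ->] ->]; exists (j + s.+1)%N.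
    by rewrite -addSn natrD opprD addrA.
  have lad : lbr h (so_unit K a b) = - s.+1%:R *: so_unit K a b.
    by rewrite lbr_cartan_unit // hs opprD addrA subrr add0r.
  rewrite scale0r subr0 -[v](subrK (av *: z)) lactDr uevD.
  rewrite shift_prod_killl ?add0r; last by rewrite (shift_prod_ladder _ _ _ lad) kv lact0r.
  rewrite lactZr uevZ shift_prod_killr ?scaler0 // shift_prod_cons shift_prod_nil.
  have := lact_lbr rho h (so_unit K a b) z; rewrite lad lactZl hz lactZr => /eqP.
  by rewrite eq_sym subr_eq => /eqP->; rewrite -scalerDl -scalerBl [- _ + c]addrC subrr scale0r.
Qed.

Section Irreducible.
Variables (V : vectType K) (rho : lieAction g V) (v : V) (h : g) (c : K).
Hypotheses (irr : is_irreducible rho) (v0 : v != 0) (sv : singular_vector rho v).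
Hypotheses (hr : regular_cartan h) (hv : rho h v = c *: v).

(** Concatenate the annihilating polynomials of the basis vectors. With all roots below [c] the
    result acts on [v] by a nonzero scalar, so it is the rank one operator that Burnside's theorem
    asks for. *)
Lemma irreducible_low : exists rs, below c rs /\
  forall y, exists a, uev rho (shift_prod h rs) y = a *: v.
Proof.
pose d : nat := \dim {:V}; pose b := vbasis {:V}.
have [rs [brs ks]] : exists rs, below c rs /\
    forall i, i \in enum 'I_d -> exists a, uev rho (shift_prod h rs) (b`_i - a *: v) = 0.
  elim: (enum 'I_d) => [|i r [rs [brs ks]]]; first by exists [::].
  have [u ui] := irreducible_cyclic irr b`_i v0.
  have [a [rs' [brs' ks']]] := singular_vector_low u sv hr hv.
  exists (rs' ++ rs); split=> [|j]; first exact: below_cat.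
  rewrite inE => /predU1P[->|/ks[a' k']].
    by exists a; rewrite shift_prod_killl // -ui.
  by exists a'; rewrite shift_prod_killr.
exists rs; split=> // y.
pose P y := exists a, uev rho (shift_prod h rs) y = a *: v.
have P0 : P 0 by exists 0; rewrite uev0 scale0r.
have Plin a x w : P x -> P w -> P (a *: x + w).
  by move=> [e xe] [f wf]; exists (a * e + f); rewrite uevD uevZ xe wf scalerDl scalerA.
suff : P y by [].
rewrite (coord_vbasis (memvf y)); apply: (pred_sum P0 Plin) => i _.
apply: (pred_scale P0 Plin).
have [a ka] := ks i (mem_enum _ i).
exists (a * \prod_(e <- rs) (c - e)).
rewrite -[b`_i](subrK (a *: v)) uevD ka add0r uevZ.
by rewrite (shift_prod_eigen rs hv) scalerA.
Qed.

Lemma highest_weight_burnside : is_burnside rho.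
Proof.
have [rs [brs rk]] := irreducible_low.
apply: (burnside_of_rank1 irr v0 _ (shift_prod_eigen rs hv)) => //.
by apply: (below_prod_neq0 brs) => j; exact: neq_below.
Qed.

(* An element of U(g) vanishing on V but not on vectors whose weight is not
   among those of V. *)
Lemma irreducible_kill : exists rs, below c rs /\
  forall y, uev rho (shift_prod h (c :: rs)) y = 0.
Proof.
have [rs [brs rk]] := irreducible_low.
exists rs; split=> // y; have [a ya] := rk y.
by rewrite shift_prod_cons ya lactZr hv !scalerA mulrC subrr.
Qed.

End Irreducible.

(** The polynomial in [h] that kills [V2] has roots [c2] or below, so it does not kill [v1];
    [burnside_ideal] then makes it the identity on [V1]. *)
Lemma hw_separated (V1 V2 : vectType K) (rho1 : lieAction g V1) (rho2 : lieAction g V2)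
    v1 v2 (h : g) c1 c2 :
  is_irreducible rho1 -> v1 != 0 -> singular_vector rho1 v1 -> rho1 h v1 = c1 *: v1 ->
  is_irreducible rho2 -> v2 != 0 -> singular_vector rho2 v2 -> rho2 h v2 = c2 *: v2 ->
  regular_cartan h -> (forall j, c1 != c2 - j%:R) ->
  exists2 u, (forall y, uev rho2 u y = 0) & (forall y, uev rho1 u y = y).
Proof.
move=> i1 n1 s1 e1 i2 n2 s2 e2 hr ne.
have [rs [brs k]] := irreducible_kill i2 n2 s2 hr e2.
apply: (burnside_ideal i1 (highest_weight_burnside i1 n1 s1 hr e1) k) => /(_ v1)/eqP.
rewrite (shift_prod_eigen _ e1) scaler_eq0 (negPf n1) orbF big_cons mulf_eq0.
rewrite (negPf (below_prod_neq0 brs _)) ?orbF ?subr_eq0.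
  by have := ne 0%N; rewrite subr0 => /negPf->.
by move=> j; exact: ne.
Qed.

Section Pair.
Variables (V : vectType K) (rho : lieAction g V) (v : V).
Variables (W : lmodType K) (sigma : lieAction g W) (w : W).

Definition pair_act (x : g) (p : W * V) : W * V := (sigma x p.1, rho x p.2).
Fact pair_act_linl p : linear (pair_act^~ p).
Proof. by move=> a x y; rewrite /pair_act !lact_linl. Qed.
Fact pair_act_linr x : linear (pair_act x).
Proof. by move=> a p q; rewrite /pair_act !lact_linr. Qed.
Fact pair_act_lbr x y p :
  pair_act (lbr x y) p = pair_act x (pair_act y p) - pair_act y (pair_act x p).
Proof. by rewrite /pair_act !lact_lbr. Qed.
Definition pairAction : lieAction g (W * V)%type :=
  LieAction pair_act_linl pair_act_linr pair_act_lbr.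

Lemma uev_pair u p : uev pairAction u p = (uev sigma u p.1, uev rho u p.2).
Proof.
elim: u p => [c|x|a IHa b IHb|a IHa b IHb] p //=; first by rewrite IHa IHb.
by rewrite IHb IHa.
Qed.

Hypotheses (irr : is_irreducible rho) (v0 : v != 0) (w0 : w != 0).
Hypotheses (sv : singular_vector rho v) (sw : singular_vector sigma w).
Hypothesis same_weight : forall h a, in_cartan h -> rho h v = a *: v -> sigma h w = a *: w.

(* Otherwise (0, v) would lie in the cyclic module generated by (w, v), whose
   weight space of weight that of v is the line spanned by (w, v). *)
Lemma kernel_incl h : regular_cartan h -> forall u,
  (forall y, uev sigma u y = 0) -> forall y, uev rho u y = 0.
Proof.
move=> hr u ku; apply/not_notP => nu.
have [c hv] := sv.1 h hr.1.
have [u' kw iv] :=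
  burnside_ideal irr (highest_weight_burnside irr v0 sv hr hv) ku nu.
have spair : singular_vector pairAction (w, v).
  split=> [h' hh'|a b ab]; last by rewrite /= /pair_act /= sv.2 // sw.2.
  have [a va] := sv.1 h' hh'; exists a.
  by rewrite /= /pair_act /= va (same_weight hh' va).
have hwv : pairAction h (w, v) = c *: (w, v).
  by rewrite /= /pair_act /= hv (same_weight hr.1 hv).
have [a [rs [brs]]] := singular_vector_low u' spair hr hwv.
(* Here [u'] sends (w, v) to (0, v). The first component forces [a = 0], and then the second reads p
   v = 0. *)
rewrite uevB uevZ (shift_prod_eigen _ hwv) !uev_pair kw iv /= uev0.
rewrite (shift_prod_eigen _ hv); set p := \prod_(_ <- _) _.
have p0 : p != 0 by apply: (below_prod_neq0 brs) => j; exact: neq_below.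
move=> [/eqP]; rewrite sub0r oppr_eq0 scalerA scaler_eq0 (negPf w0) orbF.
rewrite mulf_eq0 (negPf p0) orbF => /eqP ->.
by rewrite scale0r subr0 => /eqP; rewrite scaler_eq0 (negPf p0) (negPf v0).
Qed.

End Pair.

End HighestWeight.

(** * Fock space *)

Section Fock.
Variable K : fieldType.

(* z true i and z false i are creation and annihilation operators on the Fock
   space, kap is its grading, and v is the state whose occupied modes are A. *)
Lemma fock_space (n : nat) :
  exists D (z : bool -> nat -> 'M[K]_D.+1) (kap : 'M[K]_D.+1),
  [/\ forall s t i j, (i < n)%N -> (j < n)%N ->
        z s i * z t j + z t j * z s i = ((s != t) && (i == j))%:R,
      kap * kap = 1,
      forall s i, (i < n)%N -> kap * z s i = - (z s i * kap) &
      forall A : nat -> bool, exists2 v : 'cV[K]_D.+1, v != 0 &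
        forall i, (i < n)%N -> z (A i) i *m v = 0].
Proof.
elim: n => [|n [D [z [kap [zz kk kz zv]]]]].
  exists 0%N, (fun _ _ => 0), 1; split=> //; first by rewrite mulr1.
  move=> A; exists (const_mx 1) => //; apply/eqP => /matrixP/(_ 0 0)/eqP.
  by rewrite !mxE oner_eq0.
(* Jordan-Wigner doubling: the new mode exchanges two copies of the space, on which the old modes
   and the grading act with opposite signs so as to anticommute with it. *)
pose zn s : 'M[K]_(D.+1 + D.+1) := if s then block_mx 0 0 1 0 else block_mx 0 1 0 0.
pose zi s i : 'M[K]_(D.+1 + D.+1) := block_mx (z s i) 0 0 (- z s i).
pose z' s i := if (i < n)%N then zi s i else zn s.
pose kap' : 'M[K]_(D.+1 + D.+1) := block_mx kap 0 0 (- kap).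
have one : 1%:M = 1 :> 'M[K]_(D.+1) by [].
have one' (a : K) : (a%:M : 'M[K]_(D.+1 + D.+1)) = block_mx a%:M 0 0 a%:M by exact: scalar_mx_block.
have znn s t : zn s *m zn t + zn t *m zn s = (s != t)%:R%:M.
  rewrite one' /zn; case: s t => [] [];
    rewrite !mulmx_block add_block_mx ?(mul0mx, mulmx0, mulmx1, mul1mx) ?(addr0, add0r) //=;
    by rewrite raddf0.
have zin s t i : zi s i *m zn t + zn t *m zi s i = 0.
  rewrite /zn /zi; case: t; rewrite !mulmx_block add_block_mx;
    rewrite ?(mul0mx, mulmx0, mulmx1, mul1mx) ?(addr0, add0r);
    by rewrite ?(addNr, addrN) block_mx0.
have zii s t i j : (i < n)%N -> (j < n)%N ->
    zi s i *m zi t j + zi t j *m zi s i = ((s != t) && (i == j))%:R%:M.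
  move=> lt_i lt_j; have e := zz s t i j lt_i lt_j.
  rewrite one' /zi !mulmx_block add_block_mx ?(mul0mx, mulmx0, mulmxN, mulNmx, opprK) ?(addr0, add0r).
  rewrite !mulmxE e.
  by case: (_ && _); rewrite ?raddf0.
have kk' : kap' *m kap' = 1%:M.
  rewrite one' /kap' mulmx_block !(mul0mx, mulmx0, mulmxN, mulNmx, opprK) !(addr0, add0r).
  by rewrite mulmxE kk.
have kzi s i : (i < n)%N -> kap' *m zi s i = - (zi s i *m kap').
  move=> lt_i; rewrite /kap' /zi !mulmx_block opp_block_mx.
  rewrite !(mul0mx, mulmx0, mulmxN, mulNmx, opprK) !(addr0, add0r).
  by rewrite oppr0 !mulmxE kz // opprK.
have kzn s : kap' *m zn s = - (zn s *m kap').
  rewrite /kap' /zn; case: s; rewrite !mulmx_block opp_block_mx;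
    by rewrite !(mul0mx, mulmx0, mulmx1, mul1mx) ?(addr0, add0r) ?oppr0 ?opprK.
exists (D + D.+1)%N, z', kap'; split.
- move=> s t i j; rewrite !ltnS /z' => le_i le_j.
  case: ltnP => [lt_i|ge_i]; case: ltnP => [lt_j|ge_j].
  + by have := zii s t i j lt_i lt_j; case: (_ && _) => // ->; rewrite raddf0.
  + have -> : (i == j) = false by apply/eqP => ij; rewrite ij ltnNge ge_j in lt_i.
    by rewrite andbF; exact: zin.
  + have -> : (i == j) = false by apply/eqP => ij; rewrite -ij ltnNge ge_i in lt_j.
    by rewrite andbF addrC; exact: zin.
  + have -> : (i == j) by rewrite eqn_leq (leq_trans le_i ge_j) (leq_trans le_j ge_i).
    by rewrite andbT; have := znn s t; case: (s != t) => // ->; rewrite raddf0.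
- exact: kk'.
- by move=> s i _; rewrite /z'; case: ltnP => [lt_i|ge_i]; [apply: kzi | apply: kzn].
- move=> A; have [v v0 Av] := zv A.
  exists (if A n then col_mx 0 v else col_mx v 0).
    suff : (if A n then col_mx 0 v else col_mx v 0) != 0 :> 'cV[K]_(D.+1 + D.+1) by [].
    by case: (A n); rewrite col_mx_eq0 negb_and v0 ?orbT.
  move=> i; rewrite ltnS /z' => le_i; case: ltnP => [lt_i|ge_i].
    suff : zi (A i) i *m (if A n then col_mx 0 v else col_mx v 0) = 0 by [].
    case: (A n); rewrite mul_block_col !(mul0mx, mulmx0) ?(addr0, add0r) ?mulNmx Av //;
      by rewrite ?oppr0 col_mx0.
  have -> : i = n by apply/eqP; rewrite eqn_leq le_i ge_i.
  suff : zn (A n) *m (if A n then col_mx 0 v else col_mx v 0) = 0 by [].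
  by rewrite /zn; case: (A n); rewrite mul_block_col !(mul0mx, mulmx0) ?(addr0, add0r) col_mx0.
Qed.
End Fock.

(** * Evaluation of polynomials at commuting operators *)

Section NoncommutativeIdentities.
Variable S : pzRingType.
Implicit Types a b c d : S.

(** Only anticommutators appear inside the right-hand side, so Clifford relations yield commutators
    of quadratic operators. *)
Lemma commutator_bilinear a b c d :
  a * b * (c * d) - c * d * (a * b) =
  a * (b * c + c * b) * d - (a * c + c * a) * b * d
  + c * a * (b * d + d * b) - c * (a * d + d * a) * b.
Proof.
rewrite !(mulrDl, mulrDr) !mulrA.
set p := a * b * c * d; set q := a * c * b * d; set r := c * a * b * d.
set s := c * a * d * b; set t := c * d * a * b.
by rewrite [r + s]addrC !opprD !addrA addrK [_ + s + r]addrAC subrK addrK.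
Qed.

Lemma commutator_anti a b c :
  a * b * c - c * (a * b) = a * (b * c + c * b) - (a * c + c * a) * b.
Proof. by rewrite mulrDr mulrDl !mulrA opprD addrA addrK. Qed.

Lemma commutatorM p a b : p * (a * b) - a * b * p = (p * a - a * p) * b + a * (p * b - b * p).
Proof. by rewrite mulrBl mulrBr !mulrA addrA subrK. Qed.

(** A monomial of degree k + 1 in k commuting variables repeats one of them. The induction splits
    off one variable and uses (t + s)^(l+1) = s^(l+1) + (l+1) t s^l. *)
Lemma sum_sq0_nilpotent (k : nat) (tau : 'I_k -> S) :
  (forall j, tau j * tau j = 0) -> (forall i j, tau i * tau j = tau j * tau i) ->
  (\sum_j tau j) ^+ k.+1 = 0.
Proof.
move=> sq0 tauC.
elim: k tau sq0 tauC => [|k IH] tau sq0 tauC; first by rewrite big_ord0 expr1.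
rewrite big_ord_recl; set t := tau ord0; set s := \sum_(i < k) _.
have ts : t * s = s * t.
  by rewrite mulr_sumr mulr_suml; apply: eq_bigr => i _; exact: tauC.
have sk : s ^+ k.+1 = 0 by apply: IH.
have e l : (t + s) ^+ l.+1 = s ^+ l.+1 + (t * s ^+ l) *+ l.+1.
  elim: l => [|l IHl]; first by rewrite !expr1 expr0 mulr1 addrC.
  rewrite exprS IHl mulrDl !mulrDr !mulrnAr !mulrA sq0 mul0r mul0rn addr0.
  by rewrite -ts -!mulrA -!exprS addrCA -mulrS.
by rewrite e exprS sk !mulr0 mul0rn addr0.
Qed.

End NoncommutativeIdentities.

Section CommutingEvaluation.
Variables (K : fieldType) (n : nat).

Lemma mpoly_alg_ind (P : {mpoly K[n]} -> Prop) :
  P 1 -> (forall i p, P p -> P ('X_i * p)) ->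
  (forall a p q, P p -> P q -> P (a *: p + q)) -> forall p, P p.
Proof.
move=> P1 PX Pl.
have P0 : P 0 by have := Pl (-1) 1 1 P1 P1; rewrite scaleN1r addNr.
move=> p; elim/mpolyind: p => [//|c m p _ _ Pp]; apply: Pl => //.
rewrite mpolyXE_id; elim/big_rec: _ => [//|i q _ Pq].
by elim: (m i) => [|k IHk]; rewrite ?expr0 ?mul1r // exprS -mulrA; apply: PX.
Qed.

Variables (S : algType K) (h : 'I_n -> S).
Hypothesis hC : forall i j, h i * h j = h j * h i.

Definition ceval (p : {mpoly K[n]}) : S := mmap (in_alg S) h p.

Lemma ceval_linear : linear ceval.
Proof. by move=> a p q; rewrite /ceval mmapD mmapZ /= mulr_algl. Qed.
HB.instance Definition _ := GRing.isLinear.Build K {mpoly K[n]} S _ ceval ceval_linear.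

Lemma ceval1 : ceval 1 = 1.
Proof. by rewrite /ceval -mpolyC1 mmapC /= scale1r. Qed.

(** [mmap] multiplies the powers in the order of the indices, so [h i] has to be moved past the
    powers of the variables before it. *)
Lemma ceval_Xmul i p : ceval ('X_i * p) = h i * ceval p.
Proof.
elim/mpolyind: p => [|c m p _ _ IH]; first by rewrite mulr0 !linear0 mulr0.
rewrite mulrDr -scalerAr !linearD !linearZ /= IH mulrDr -scalerAr.
congr (_ *: _ + _); rewrite -mpolyXD /ceval !mmapX /mmap1.
have X (r : seq 'I_n) : uniq r -> \prod_(j <- r) h j ^+ (U_(i) + m)%MM j =
    (if i \in r then h i else 1) * \prod_(j <- r) h j ^+ m j.
  elim: r => [|j r IHr] /=; first by rewrite !big_nil mulr1.
  move=> /andP[jr ur]; rewrite !big_cons IHr // mnmDE mnm1E inE.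
  have [->|ij] := eqVneq i j; first by rewrite (negPf jr) /= mul1r add1n exprS mulrA.
  rewrite add0n orFb; case: (i \in r); last by rewrite !mul1r.
  have /commrX c1 : GRing.comm (h i) (h j) by exact: hC.
  by rewrite !mulrA c1.
by rewrite X ?index_enum_uniq // mem_index_enum.
Qed.

Lemma cevalX i : ceval 'X_i = h i.
Proof. by rewrite -['X_i]mulr1 ceval_Xmul ceval1 mulr1. Qed.

Lemma cevalM p q : ceval (p * q) = ceval p * ceval q.
Proof.
elim/mpoly_alg_ind: p => [|i p IH|a p p' IHp IHp'].
- by rewrite ceval1 !mul1r.
- by rewrite -mulrA !ceval_Xmul IH mulrA.
- by rewrite mulrDl -scalerAl !linearP /= IHp IHp' mulrDl scalerAl.
Qed.

End CommutingEvaluation.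

(** * Bivectors and the spin action *)

Section BilinearSums.
Variables (K : fieldType) (m : nat).
Local Notation N := m.*2.+1.
Local Notation g := (so K m).

(* Bivectors: with u_a the basis of the standard module, x corresponds to
   \sum_a \sum_b x_ab u_a u_(rev b). *)
Definition bivec (S : algType K) (u : 'I_N -> S) (x : g) : S :=
  \sum_a \sum_b val x a b *: (u a * u (rev_ord b)).

Variable (S : algType K).
Implicit Type u : 'I_N -> S.

Lemma bivecP u c (x y : g) : bivec u (c *: x + y) = c *: bivec u x + bivec u y.
Proof.
rewrite /bivec scaler_sumr -big_split; apply: eq_bigr => a _ /=.
rewrite scaler_sumr -big_split; apply: eq_bigr => b _ /=.
by rewrite !mxE scalerDl scalerA.
Qed.

Lemma bivec_unit u p q :
  bivec u (so_unit K p q) = u p * u (rev_ord q) - u (rev_ord q) * u p.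
Proof.
have pick a0 b0 : \sum_a \sum_b ((a == a0) && (b == b0))%:R *: (u a * u (rev_ord b))
    = u a0 * u (rev_ord b0).
  rewrite (bigD1 a0) //= [X in _ + X]big1 => [|a aa]; last first.
    by rewrite big1 // => b _; rewrite (negPf aa) scale0r.
  rewrite (bigD1 b0) //= big1 => [|b bb]; last by rewrite (negPf bb) andbF scale0r.
  by rewrite !eqxx scale1r !addr0.
rewrite /bivec; under eq_bigr => a _ do under eq_bigr => b _ do rewrite so_unitE scalerBl.
under eq_bigr => a _ do rewrite sumrB.
by rewrite sumrB !pick rev_ordK.
Qed.

(** The commutator with [p] is a derivation acting on the span of the [u a] as [x] acts on the
    standard module; antisymmetry of [x] turns its effect on the second factor into the term -yx.
    This serves both the spin operators and the creation operators. *)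
Lemma bivec_commutator u p (x y : g) :
  (forall c, p * u c - u c * p = \sum_a val x a c *: u a) ->
  p * bivec u y - bivec u y * p = bivec u (lbr x y).
Proof.
move=> pu.
rewrite /bivec mulr_sumr mulr_suml -sumrB.
have -> : \sum_a (p * (\sum_b val y a b *: (u a * u (rev_ord b))) -
    (\sum_b val y a b *: (u a * u (rev_ord b))) * p) =
  \sum_a \sum_b \sum_c (val y a b * val x c a) *: (u c * u (rev_ord b)) +
  \sum_a \sum_b \sum_c (val y a b * val x c (rev_ord b)) *: (u a * u c).
  rewrite -big_split; apply: eq_bigr => a _ /=.
  rewrite mulr_sumr mulr_suml -sumrB -big_split; apply: eq_bigr => b _ /=.
  rewrite -scalerAr -scalerAl -scalerBr commutatorM !pu scalerDr mulr_suml mulr_sumr.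
  rewrite !scaler_sumr; congr (_ + _); apply: eq_bigr => c _.
    by rewrite -scalerAl scalerA.
  by rewrite -scalerAr scalerA.
have -> : \sum_a \sum_b \sum_c (val y a b * val x c (rev_ord b)) *: (u a * u c) =
  - \sum_a \sum_b (val y *m val x) a b *: (u a * u (rev_ord b)).
  rewrite -sumrN; apply: eq_bigr => a _; rewrite exchange_big -sumrN /=.
  rewrite (reindex_inj rev_ord_inj) /=; apply: eq_bigr => c _.
  rewrite mxE scaler_suml -sumrN; apply: eq_bigr => b _.
  by rewrite so_entry mulrN scaleNr.
have -> : \sum_a \sum_b \sum_c (val y a b * val x c a) *: (u c * u (rev_ord b)) =
  \sum_a \sum_b (val x *m val y) a b *: (u a * u (rev_ord b)).
  under eq_bigr => a _ do rewrite exchange_big /=.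
  rewrite exchange_big /=; apply: eq_bigr => c _.
  rewrite exchange_big /=; apply: eq_bigr => b _.
  by rewrite mxE scaler_suml; apply: eq_bigr => a _; rewrite mulrC.
rewrite -sumrB; apply: eq_bigr => a _; rewrite -sumrB; apply: eq_bigr => b _.
by rewrite -scalerBl !mxE.
Qed.

End BilinearSums.

Section CliffordModule.
Variables (K : numFieldType) (m k D : nat).
Local Notation N := m.*2.+1.
Local Notation g := (so K m).
Local Notation E := 'M[K]_D.+1.
Variables (G : 'I_k -> 'I_N -> E) (kap : E).
Hypothesis GG : forall j a l b,
  G j a * G l b + G l b * G j a = (((j == l) && (b == rev_ord a))%:R *+ 2)%:M.
Hypotheses (kapK : kap * kap = 1) (kapG : forall j a, kap * G j a = - (G j a * kap)).

(** The factor 1/4 makes [spin_G] hold without a constant: anticommutators contribute a 2, and the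
    two factors of a bivector contribute equally. *)
Definition spin (x : g) : E := 4^-1 *: \sum_j bivec (G j) x.

Lemma spin_linear : linear spin.
Proof.
move=> c x y; rewrite /spin.
have -> : \sum_j bivec (G j) (c *: x + y) = c *: \sum_j bivec (G j) x + \sum_j bivec (G j) y.
  by rewrite scaler_sumr -big_split; apply: eq_bigr => j _; exact: bivecP.
by rewrite scalerDr !scalerA [c * _]mulrC.
Qed.
HB.instance Definition _ := GRing.isLinear.Build K g E _ spin spin_linear.

Lemma spin_G x j c : spin x * G j c - G j c * spin x = \sum_a val x a c *: G j a.
Proof.
have GGG l a b : G l a * G l b * G j c - G j c * (G l a * G l b) =
    (((l == j) && (c == rev_ord b))%:R *+ 2) *: G l a
    - (((l == j) && (c == rev_ord a))%:R *+ 2) *: G l b.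
  by rewrite commutator_anti !GG -!mulmxE mul_mx_scalar mul_scalar_mx.
rewrite /spin -scalerAl -scalerAr -scalerBr mulr_suml mulr_sumr -sumrB.
rewrite (bigD1 j) //= [X in _ + X]big1 => [|l lj]; last first.
  rewrite /bivec mulr_suml mulr_sumr -sumrB big1 // => a _.
  rewrite mulr_suml mulr_sumr -sumrB big1 // => b _.
  by rewrite -scalerAl -scalerAr -scalerBr GGG (negPf lj) /= !mul0rn !scale0r subrr scaler0.
rewrite addr0 /bivec mulr_suml mulr_sumr -sumrB.
have -> : \sum_a ((\sum_b val x a b *: (G j a * G j (rev_ord b))) * G j c -
      G j c * (\sum_b val x a b *: (G j a * G j (rev_ord b)))) =
   \sum_a \sum_b (val x a b * ((c == b)%:R *+ 2)) *: G j a -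
   \sum_a \sum_b (val x a b * ((c == rev_ord a)%:R *+ 2)) *: G j (rev_ord b).
  rewrite -sumrB; apply: eq_bigr => a _; rewrite mulr_suml mulr_sumr -!sumrB.
  apply: eq_bigr => b _; rewrite -scalerAl -scalerAr -scalerBr GGG eqxx rev_ordK /=.
  by rewrite scalerBr !scalerA.
have -> : \sum_a \sum_b (val x a b * ((c == b)%:R *+ 2)) *: G j a =
   2 *: \sum_a val x a c *: G j a.
  rewrite scaler_sumr; apply: eq_bigr => a _; rewrite (bigD1 c) //= big1 => [|b bc].
    by rewrite eqxx addr0 scalerA mulrC.
  by rewrite eq_sym (negPf bc) mul0rn mulr0 scale0r.
have -> : \sum_a \sum_b (val x a b * ((c == rev_ord a)%:R *+ 2)) *: G j (rev_ord b) =
   - (2 *: \sum_a val x a c *: G j a).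
  rewrite scaler_sumr -sumrN (bigD1 (rev_ord c)) //= [X in _ + X]big1 => [|a ac].
    rewrite addr0 (reindex_inj rev_ord_inj) /=; apply: eq_bigr => b _.
    by rewrite !rev_ordK eqxx so_entry mulNr scaleNr scalerA mulrC.
  apply: big1 => b _; case: eqP => [ca|]; last by rewrite mul0rn mulr0 scale0r.
  by rewrite ca rev_ordK eqxx in ac.
rewrite opprK -scalerDl scalerA -natrD mulVf ?scale1r //.
by rewrite pnatr_eq0.
Qed.

Lemma spin_lbr x y : spin (lbr x y) = spin x * spin y - spin y * spin x.
Proof.
have := spin_G x; move: (spin x) => sx sG.
rewrite /spin -scalerAr -scalerAl -scalerBr mulr_sumr mulr_suml -sumrB.
congr (_ *: _); apply: eq_bigr => j _; symmetry; apply: bivec_commutator => c.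
exact: sG.
Qed.

Definition spin_act (x : g) (v : 'cV[K]_D.+1) := spin x *m v.
Fact spin_act_linl v : linear (spin_act^~ v).
Proof. by move=> a x y; rewrite /spin_act linearP mulmxDl -scalemxAl. Qed.
Fact spin_act_linr x : linear (spin_act x).
Proof. by move=> a v w; rewrite /spin_act mulmxDr -scalemxAr. Qed.
Fact spin_act_lbr x y v :
  spin_act (lbr x y) v = spin_act x (spin_act y v) - spin_act y (spin_act x v).
Proof. by rewrite /spin_act spin_lbr mulmxBl -!mulmxE !mulmxA. Qed.
Definition spinAction : lieAction g 'cV[K]_D.+1 :=
  LieAction spin_act_linl spin_act_linr spin_act_lbr.

End CliffordModule.

(** * Exterior multiplication on the Clifford algebra *)

Import FalgLfun.

Section Quantization.
Variables (K : numFieldType) (m k D : nat).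
Local Notation N := m.*2.+1.
Local Notation g := (so K m).
Local Notation E := 'M[K]_D.+1.
Local Notation A := (bool * 'I_N)%type.
Variables (G : 'I_k -> 'I_N -> E) (kap : E).
Hypothesis GG : forall j a l b,
  G j a * G l b + G l b * G j a = (((j == l) && (b == rev_ord a))%:R *+ 2)%:M.
Hypotheses (kapK : kap * kap = 1) (kapG : forall j a, kap * G j a = - (G j a * kap)).

Definition sgn (s : bool) : K := if s then 1 else -1.

(* Exterior (s = true) and interior multiplication by G_(j,a) on E, which as a
   filtered algebra deforms an exterior algebra. *)
Definition cliff_fun (al : A) (j : 'I_k) (w : E) : E :=
  2^-1 *: (G j al.2 * w + sgn al.1 *: (kap * w * kap * G j al.2)).

Fact cliff_fun_linear al j : linear (cliff_fun al j).
Proof.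
move=> c v w; rewrite /cliff_fun !(mulrDr, mulrDl) -!scalerAr -!scalerAl !scalerDr !scalerA.
by rewrite addrACA [2^-1 * c]mulrC -!mulrA [sgn _ * c]mulrC !mulrA [2^-1 * c]mulrC.
Qed.
HB.instance Definition _ al j := GRing.isLinear.Build K E E _ (cliff_fun al j) (cliff_fun_linear al j).

Definition cliff al j : 'End(E) := linfun (cliff_fun al j).

Lemma cliffE al j w : cliff al j w = 2^-1 *: (G j al.2 * w + sgn al.1 *: (kap * w * kap * G j al.2)).
Proof. by rewrite lfunE. Qed.

Definition cliff_form (al be : A) := (al.1 != be.1) && (be.2 == rev_ord al.2).

(** Conjugation by [kap] is the parity automorphism, so left multiplication and twisted right
    multiplication by generators anticommute, and the right ones satisfy the Clifford relations with
    opposite sign. In half sums and half differences these cancel for equal types and add up for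
    opposite types. *)
Lemma cliff_anticomm al j be l : cliff al j * cliff be l + cliff be l * cliff al j = ((j == l) && cliff_form al be)%:R.
Proof.
apply/lfunP => w; rewrite add_lfunE !lfun_mulE !cliffE.
have flip (s t : K) (a b : E) : kap * a = - (a * kap) -> kap * b = - (b * kap) ->
    2^-1 *: (b * (2^-1 *: (a * w + s *: (kap * w * kap * a))) +
      t *: (kap * (2^-1 *: (a * w + s *: (kap * w * kap * a))) * kap * b)) =
    4^-1 *: (b * a * w - (s * t) *: (w * a * b) + (s *: (b * kap * w * kap * a) - t *: (a * kap * w * kap * b))).
  move=> ka kb.
  have -> : 4^-1 = 2^-1 * 2^-1 :> K by rewrite -invfM -natrM.
  have sc (v : E) : t *: (2^-1 *: v) = 2^-1 *: (t *: v) by rewrite !scalerA mulrC.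
  rewrite -!scalerAr -!scalerAl sc -scalerDr scalerA.
  congr (_ *: _); rewrite !(mulrDl, mulrDr) -!scalerAr -!scalerAl !scalerDr !mulrA.
  have e1 : kap * a * w * kap * b = - (a * kap * w * kap * b) by rewrite ka !mulNr.
  have e2 : kap * kap * w * kap * a * kap * b = - (w * a * b).
    rewrite kapK mul1r -[w * kap * a * kap]mulrA -[w * kap * _]mulrA [kap * (a * kap)]mulrA.
    by rewrite ka mulNr -[a * kap * kap]mulrA kapK mulr1 mulrN mulNr.
  by rewrite e1 e2 !scalerN scalerA [t * s]mulrC [X in _ + X = _]addrC addrACA.
rewrite !(flip _ _ _ _ (kapG _ _) (kapG _ _)) -scalerDr.
move: (GG l be.2 j al.2) (kapG l be.2) (kapG j al.2).
move: (G l be.2) (G j al.2) => b a ba kb ka.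
set X := _ *: (b * kap * w * kap * a); set Y := _ *: (a * kap * w * kap * b).
rewrite addrACA [X - Y + _]addrA subrK subrr addr0 addrACA [sgn be.1 * _]mulrC.
rewrite -opprD -scalerDr -mulrDl -!mulrA -mulrDr [a * b + _]addrC ba.
rewrite -!mulmxE mul_mx_scalar mul_scalar_mx scalerA -scalerBl scalerA.
have -> : (l == j) && (al.2 == rev_ord be.2) = (j == l) && (be.2 == rev_ord al.2).
  by rewrite eq_sym; congr (_ && _); apply/eqP/eqP => ->; rewrite rev_ordK.
rewrite /cliff_form; case: (j == l); case: (be.2 == _); case: al.1; case: be.1; rewrite /=.
all: rewrite ?(mul0rn, mulr0, mulr1, mul1r, mulN1r, mulrNN, opprK, subrr, scale0r).
all: rewrite ?zero_lfunE // -mulrnDr mulVf ?pnatr_eq0 // scale1r.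
all: exact/esym/id_lfunE.
Qed.

Lemma creation1 a j : cliff (true, a) j 1 = G j a.
Proof. by rewrite cliffE /= !mulr1 kapK mul1r scale1r -mulr2n -scaler_nat scalerA mulVf ?scale1r // pnatr_eq0. Qed.

Lemma annihilation1 a j : cliff (false, a) j 1 = 0.
Proof. by rewrite cliffE /= !mulr1 kapK mul1r scaleN1r subrr scaler0. Qed.

Lemma cliff_gen t b i a j : cliff (t, b) i (G j a) = 2^-1 *: (G i b * G j a - sgn t *: (G j a * G i b)).
Proof. by rewrite cliffE /= kapG mulNr -[_ * kap * kap]mulrA kapK mulr1 mulNr scalerN. Qed.

Lemma gen_cliff a j w : G j a * w = cliff (true, a) j w + cliff (false, a) j w.
Proof.
rewrite !cliffE /= scale1r scaleN1r -scalerDr addrACA subrr addr0 -mulr2n -scaler_nat.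
by rewrite scalerA mulVf ?scale1r // pnatr_eq0.
Qed.

(** Products in ['End(E)] compose from left to right: [cliff al j] is applied first. *)
Definition quad (al be : A) : 'End(E) := \sum_j cliff al j * cliff be j.

Lemma quadE al be w : quad al be w = \sum_j cliff be j (cliff al j w).
Proof. by rewrite sum_lfunE; apply: eq_bigr => j _; rewrite lfun_mulE. Qed.

Lemma quad_commutator al be ga de : quad al be * quad ga de - quad ga de * quad al be =
  (cliff_form be ga)%:R *: quad al de - (cliff_form al ga)%:R *: quad be de
  + (cliff_form be de)%:R *: quad ga al - (cliff_form al de)%:R *: quad ga be.
Proof.
rewrite /quad mulr_suml mulr_sumr -sumrB !scaler_sumr -sumrB -big_split -sumrB /=.
apply: eq_bigr => j _; rewrite mulr_sumr mulr_suml -sumrB (bigD1 j) //= [X in _ + X]big1 => [|l lj].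
  by rewrite commutator_bilinear !cliff_anticomm eqxx addr0 /= -!scaler_nat -!(scalerAl, scalerAr) ?mulr1 ?mul1r.
by rewrite commutator_bilinear !cliff_anticomm [j == l]eq_sym (negPf lj) ?(mulr0, mul0r, subrr, addr0).
Qed.

Section Core.
Variable P : E -> Prop.
Hypotheses (P0 : P 0) (Plin : forall a u v, P u -> P v -> P (a *: u + v)).

(** Meant for [P] the image of U(so) or of the symbols. If all of [P] lies in its core, then [P] is
    stable under every [quad], hence under the generators of the other image. *)
Definition quad_core w := P w /\ forall al be, P (quad al be w).

(* Commutators of quadratic operators are quadratic, so an operator o that is
   quadratic and preserves P also preserves the w all of whose quad w lie in P. *)
Lemma core_step (o : E -> E) (t : A -> A -> K) :
  (forall w, o w = \sum_ga \sum_de t ga de *: quad ga de w) ->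
  (forall w, P w -> P (o w)) -> forall w, quad_core w -> quad_core (o w).
Proof.
move=> oE Po w [Pw PQ]; split=> [|al be]; first exact: Po.
have sw ga de : quad al be (quad ga de w) = quad ga de (quad al be w)
    - ((cliff_form be ga)%:R *: quad al de w - (cliff_form al ga)%:R *: quad be de w
       + (cliff_form be de)%:R *: quad ga al w - (cliff_form al de)%:R *: quad ga be w).
  have /(congr1 (fun f : 'End(E) => f w)) := quad_commutator al be ga de.
  rewrite !(add_lfunE, opp_lfunE, scale_lfunE, lfun_mulE) => <-.
  by rewrite opprB addrC subrK.
have -> : quad al be (o w) = o (quad al be w) -
    \sum_ga \sum_de t ga de *: ((cliff_form be ga)%:R *: quad al de w - (cliff_form al ga)%:R *: quad be de w
       + (cliff_form be de)%:R *: quad ga al w - (cliff_form al de)%:R *: quad ga be w).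
  rewrite !oE linear_sum -sumrB; apply: eq_bigr => ga _.
  rewrite linear_sum -sumrB; apply: eq_bigr => de _.
  by rewrite linearZ /= sw scalerBr.
have PN u v : P u -> P v -> P (u - v).
  by move=> Pu Pv; rewrite -scaleN1r addrC; apply: Plin.
have PZ := pred_scale P0 Plin.
apply: (PN); first exact: Po.
apply: (pred_sum P0 Plin) => ga _; apply: (pred_sum P0 Plin) => de _; apply: (PZ).
by apply: (PN); [apply: (pred_add Plin); [apply: (PN)|]|]; apply: (PZ).
Qed.

Lemma core_lin a u v : quad_core u -> quad_core v -> quad_core (a *: u + v).
Proof.
move=> [Pu Qu] [Pv Qv]; split=> [|al be]; first exact: Plin.
by rewrite linearP /=; apply: Plin.
Qed.

(** An annihilation applied first kills 1, a creation followed by an annihilation summed over the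
    copies gives a scalar, and two creations give a multiple of the sum in the hypothesis. *)
Lemma core_one : P 1 -> (forall a b, P (\sum_j (G j a * G j b - G j b * G j a))) ->
  quad_core 1.
Proof.
move=> P1 PG; split=> // [[s a] [t b]]; rewrite quadE.
case: s; last by rewrite big1 // => j _; rewrite annihilation1 linear0.
have PZ := pred_scale P0 Plin.
under eq_bigr => j _ do rewrite creation1 cliff_gen.
rewrite -scaler_sumr; apply: (PZ); case: t => /=.
  under eq_bigr => j _ do rewrite scale1r.
  exact: PG.
under eq_bigr => j _ do rewrite scaleN1r opprK GG eqxx /=.
apply: (pred_sum P0 Plin) => j _.
by rewrite -scalemx1; apply: (PZ).
Qed.

End Core.

Definition wedge (x : g) : 'End(E) := \sum_j bivec (fun a => cliff (true, a) j) x.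

Lemma wedgeP c (x y : g) : wedge (c *: x + y) = c *: wedge x + wedge y.
Proof. by rewrite /wedge scaler_sumr -big_split; apply: eq_bigr => j _; exact: bivecP. Qed.

Lemma creationC a j b l : cliff (true, a) j * cliff (true, b) l = - (cliff (true, b) l * cliff (true, a) j).
Proof. by apply/eqP; rewrite -addr_eq0 cliff_anticomm /cliff_form /= andbF. Qed.

Lemma creation2C a i b c l d j :
  cliff (true, a) i * cliff (true, b) l * (cliff (true, c) j * cliff (true, d) j) =
  cliff (true, c) j * cliff (true, d) j * (cliff (true, a) i * cliff (true, b) l).
Proof.
apply/eqP; rewrite -subr_eq0 commutator_bilinear !cliff_anticomm /cliff_form /= !andbF.
by rewrite ![false%:R]mulr0n !mulr0 !mul0r !(subr0, addr0).
Qed.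

Lemma wedge_comm x y : wedge x * wedge y = wedge y * wedge x.
Proof.
rewrite /wedge mulr_suml mulr_sumr; apply: eq_bigr => i _.
rewrite mulr_suml mulr_sumr; apply: eq_bigr => j _.
rewrite /bivec mulr_suml mulr_sumr; apply: eq_bigr => a _.
rewrite mulr_suml mulr_sumr; apply: eq_bigr => b _.
rewrite -scalerAl -scalerAr; congr (_ *: _).
rewrite mulr_suml mulr_sumr; apply: eq_bigr => c _.
rewrite mulr_suml mulr_sumr; apply: eq_bigr => d _.
by rewrite -scalerAl -scalerAr creation2C.
Qed.

Lemma sum_index (F : A -> E) : \sum_ga F ga = \sum_a (F (true, a) + F (false, a)).
Proof.
transitivity (\sum_s \sum_a F (s, a)); first by rewrite pair_bigA; apply: eq_bigr => [[]].
by rewrite big_bool big_split.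
Qed.

Lemma wedge_quad x w : wedge x w = \sum_ga \sum_de
  ((ga.1 && de.1)%:R * val x ga.2 (rev_ord de.2)) *: quad ga de w.
Proof.
rewrite sum_index sum_lfunE /bivec.
under eq_bigr => j _ do rewrite sum_lfunE.
rewrite exchange_big /=; apply: eq_bigr => a _.
rewrite [X in _ + X]big1 => [|de _]; last by rewrite mul0r scale0r.
rewrite addr0 sum_index [RHS](reindex_inj rev_ord_inj) /=.
under eq_bigr => j _ do rewrite sum_lfunE.
rewrite exchange_big /=; apply: eq_bigr => b _.
rewrite mul0r scale0r addr0 mul1r rev_ordK quadE scaler_sumr; apply: eq_bigr => j _.
by rewrite scale_lfunE lfun_mulE.
Qed.

(** Left multiplication by a generator is creation plus annihilation, so left multiplication by a
    quadratic element is a combination of [quad]s. *)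
Lemma spin_quad x w : spin G x * w = \sum_ga \sum_de
  (4^-1 * val x de.2 (rev_ord ga.2)) *: quad ga de w.
Proof.
rewrite exchange_big /= sum_index /spin -scalerAl mulr_suml /bivec.
under eq_bigr => j _ do rewrite mulr_suml.
rewrite exchange_big scaler_sumr /=; apply: eq_bigr => a _.
rewrite !sum_index -big_split [RHS](reindex_inj rev_ord_inj) /=.
under eq_bigr => j _ do rewrite mulr_suml.
rewrite exchange_big scaler_sumr /=; apply: eq_bigr => b _.
rewrite rev_ordK !quadE -!scalerDr -!big_split -scalerA.
congr (_ *: _); rewrite scaler_sumr; apply: eq_bigr => j _ /=.
by rewrite -scalerAl -mulrA !gen_cliff !linearD addrACA /= !addrA.
Qed.

End Quantization.

(** * The symbol map *)

Section SymbolMap.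
Variables (K : numFieldType) (m k D : nat).
Local Notation N := m.*2.+1.
Local Notation g := (so K m).
Local Notation E := 'M[K]_D.+1.
Variables (G : 'I_k -> 'I_N -> E) (kap : E).
Hypothesis GG : forall j a l b,
  G j a * G l b + G l b * G j a = (((j == l) && (b == rev_ord a))%:R *+ 2)%:M.
Hypotheses (kapK : kap * kap = 1) (kapG : forall j a, kap * G j a = - (G j a * kap)).
Local Notation wedge := (wedge G kap).
Local Notation cliff := (cliff G kap).
Local Notation quad := (quad G kap).
Local Notation spin := (spin G).

Fixpoint umx (u : uexp g) : E :=
  match u with
  | UC c => c%:M
  | UX x => spin x
  | UAdd a b => umx a + umx b
  | UMul a b => umx a * umx b
  end.

Lemma uev_umx u v : uev (spinAction GG) u v = umx u *m v.
Proof.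
elim: u v => [c|x|a IHa b IHb|a IHa b IHb] v /=.
- by rewrite mul_scalar_mx.
- by [].
- by rewrite IHa IHb mulmxDl.
- by rewrite IHb IHa mulmxA.
Qed.

Definition in_spin_algebra (w : E) := exists u, umx u = w.

Fact in_spin0 : in_spin_algebra 0.
Proof. by exists (UC 0); rewrite /= raddf0. Qed.
Fact in_spin_lin c w w' : in_spin_algebra w -> in_spin_algebra w' ->
  in_spin_algebra (c *: w + w').
Proof.
move=> [u <-] [u' <-]; exists (UAdd (UMul (UC c) u) u') => /=.
by rewrite -mulmxE mul_scalar_mx.
Qed.

Lemma sum_commutator a b :
  \sum_j (G j a * G j b - G j b * G j a) = 4 *: spin (so_unit K a (rev_ord b)).
Proof.
rewrite /spin scalerA mulfV ?pnatr_eq0 // scale1r; apply: eq_bigr => j _.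
by rewrite bivec_unit rev_ordK.
Qed.

Lemma core_spin_algebra w : in_spin_algebra w -> quad_core G kap in_spin_algebra w.
Proof.
move=> [u <-]; rewrite -[umx u]mulr1.
suff cu w' : quad_core G kap in_spin_algebra w' -> quad_core G kap in_spin_algebra (umx u * w').
  apply/cu/core_one => //.
  - exact: in_spin0.
  - exact: in_spin_lin.
  - by exists (UC 1).
  - move=> a b; rewrite sum_commutator.
    by rewrite -[_ *: _]addr0; apply: in_spin_lin; [exists (UX (so_unit K a (rev_ord b))) | exact: in_spin0].
elim: u w' => [c|x|a IHa b IHb|a IHa b IHb] w' cw /=.
- rewrite -mulmxE mul_scalar_mx -[_ *: _]addr0; apply: core_lin => //.
    exact: in_spin_lin.
  split=> [|al be]; first exact: in_spin0.
  by rewrite linear0; exact: in_spin0.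
- apply: (core_step GG kapK kapG in_spin0 in_spin_lin (spin_quad G kap x)) => //.
  by move=> _ [u <-]; exists (UMul (UX x) u).
- rewrite mulrDl -[umx a * _]scale1r; apply: core_lin; [exact: in_spin_lin|exact: IHa|exact: IHb].
- by rewrite -mulrA; apply/IHa/IHb.
Qed.

Fact wedge_linear : linear wedge.
Proof. by move=> c x y; exact: wedgeP. Qed.
HB.instance Definition _ := GRing.isLinear.Build K g 'End(E) _ wedge wedge_linear.

Definition symbol_op : symAlg g -> 'End(E) := ceval (fun i : 'I_(\dim {:g}) => wedge (vbasis {:g})`_i).

Lemma symbol_op_linear : linear symbol_op.
Proof. exact: ceval_linear. Qed.
HB.instance Definition _ := GRing.isLinear.Build K (symAlg g) 'End(E) _ symbol_op symbol_op_linear.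

Lemma symbol_opM p q : symbol_op (p * q) = symbol_op p * symbol_op q.
Proof. by apply: cevalM => i j; exact: wedge_comm. Qed.

Lemma symbol_op_in x : symbol_op (sym_in x) = wedge x.
Proof.
rewrite /sym_in linear_sum {2}(coord_vbasis (memvf x)) linear_sum.
apply: eq_bigr => i _; rewrite !linearZ /=; congr (_ *: _).
by apply: cevalX => ? ?; exact: wedge_comm.
Qed.

Definition symbol_map (p : symAlg g) : E := symbol_op p 1.

Lemma symbol_map_linear : linear symbol_map.
Proof. by move=> c p q; rewrite /symbol_map linearP add_lfunE scale_lfunE. Qed.
HB.instance Definition _ :=
  GRing.isLinear.Build K (symAlg g) E _ symbol_map symbol_map_linear.

Lemma symbol_map1 : symbol_map 1 = 1.
Proof. by rewrite /symbol_map /symbol_op ceval1; exact: id_lfunE. Qed.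

Lemma symbol_map_in x : symbol_map (sym_in x) = wedge x 1.
Proof. by rewrite /symbol_map symbol_op_in. Qed.

Lemma symbol_mapX i p : symbol_map ('X_i * p) = wedge (vbasis {:g})`_i (symbol_map p).
Proof.
rewrite /symbol_map mulrC symbol_opM lfun_mulE; congr (_ _).
congr (fun_of_lfun _ _). exact: (cevalX (fun i j => wedge_comm GG kapK kapG _ _)).
Qed.

Definition in_symbols (w : E) := exists p, symbol_map p = w.

Fact in_symbols0 : in_symbols 0.
Proof. by exists 0; rewrite linear0. Qed.
Fact in_symbols_lin c w w' : in_symbols w -> in_symbols w' -> in_symbols (c *: w + w').
Proof. by move=> [p <-] [q <-]; exists (c *: p + q); rewrite linearP. Qed.

Lemma core_symbols w : in_symbols w -> quad_core G kap in_symbols w.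
Proof.
move=> [p <-]; elim/mpoly_alg_ind: p => [|i p IH|a p q IHp IHq].
- rewrite symbol_map1; apply: core_one => //.
  + exact: in_symbols0.
  + exact: in_symbols_lin.
  + by exists 1; exact: symbol_map1.
  + move=> a b; exists (- sym_in (so_unit K a (rev_ord b))).
    rewrite linearN /= symbol_map_in /wedge sum_lfunE -sumrN; apply: eq_bigr => j _.
    rewrite bivec_unit rev_ordK add_lfunE opp_lfunE !lfun_mulE !creation1 // !cliff_gen // !scale1r.
    rewrite -[G j b * _ - _]opprB scalerN -opprD opprK -mulr2n -scaler_nat scalerA.
    by rewrite mulfV ?scale1r ?pnatr_eq0.
- rewrite symbol_mapX.
  apply: (core_step GG kapK kapG in_symbols0 in_symbols_lin (wedge_quad G kap _)) IH.
  by move=> _ [q <-]; exists ('X_i * q); exact: symbol_mapX.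
- by rewrite linearP /=; apply: core_lin => //; exact: in_symbols_lin.
Qed.

(** Both sides contain 1, and each is stable under every [quad] by its core lemma; the generators of
    either side are combinations of [quad]s. *)
Lemma in_symbols_spin w : in_symbols w <-> in_spin_algebra w.
Proof.
split=> [[p <-]|[u <-]].
  elim/mpoly_alg_ind: p => [|i p IH|a p q IHp IHq].
  - by rewrite symbol_map1; exists (UC 1).
  - rewrite symbol_mapX wedge_quad.
    have PZ := pred_scale in_spin0 in_spin_lin.
    apply: (pred_sum in_spin0 in_spin_lin) => ga _.
    apply: (pred_sum in_spin0 in_spin_lin) => de _.
    by apply: (PZ); case: (core_spin_algebra IH).
  - by rewrite linearP /=; apply: (in_spin_lin _ IHp IHq).
rewrite -[umx u]mulr1.
have : in_symbols 1 by exists 1; exact: symbol_map1.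
have PZ := pred_scale in_symbols0 in_symbols_lin.
elim: u 1 => [c|x|a IHa b IHb|a IHa b IHb] w' Mw /=.
- by rewrite -mulmxE mul_scalar_mx; apply: (PZ).
- rewrite (spin_quad G kap); apply: (pred_sum in_symbols0 in_symbols_lin) => ga _.
  apply: (pred_sum in_symbols0 in_symbols_lin) => de _.
  by apply: (PZ); case: (core_symbols Mw).
- by rewrite mulrDl; apply: (pred_add in_symbols_lin); [apply: IHa | apply: IHb].
- by rewrite -mulrA; apply/IHa/IHb.
Qed.

(** Minus the adjoint action: the left-to-right product of ['End(E)] reverses the commutator in
    [symbol_op_act]. *)
Definition ad_fun (x : g) (w : E) : E := w * spin x - spin x * w.
Fact ad_fun_linear x : linear (ad_fun x).
Proof.
move=> c v w; rewrite /ad_fun mulrDl mulrDr -(scalerAl c) -(scalerAr c) scalerBr.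
by rewrite opprD addrACA.
Qed.
HB.instance Definition _ x := GRing.isLinear.Build K E E _ (ad_fun x) (ad_fun_linear x).
Definition adG (x : g) : 'End(E) := linfun (ad_fun x).

Lemma adGE x w : adG x w = w * spin x - spin x * w.
Proof. by rewrite lfunE. Qed.

(** Being even, [spin x] commutes with [kap], so the commutator passes through both halves of
    exterior multiplication and reduces to [spin_G]. *)
Lemma adG_cliff x c j : adG x * cliff (true, c) j - cliff (true, c) j * adG x =
  \sum_a val x a c *: cliff (true, a) j.
Proof.
apply/lfunP => w; rewrite add_lfunE opp_lfunE !lfun_mulE.
have kx : kap * spin x = spin x * kap.
  rewrite /spin -scalerAr -scalerAl mulr_sumr mulr_suml; congr (_ *: _).
  apply: eq_bigr => l _; rewrite /bivec mulr_sumr mulr_suml; apply: eq_bigr => a _.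
  rewrite mulr_sumr mulr_suml; apply: eq_bigr => b _; rewrite -scalerAr -scalerAl.
  by rewrite mulrA kapG mulNr -mulrA kapG mulrN opprK mulrA.
rewrite !adGE; move: (spin_G GG x j c) kx; move: (spin x) => p pG kp.
have -> : (\sum_a val x a c *: cliff (true, a) j) w = 2^-1 *: ((p * G j c - G j c * p) * w
    + kap * w * kap * (p * G j c - G j c * p)).
  rewrite sum_lfunE pG // mulr_suml mulr_sumr -big_split scaler_sumr.
  apply: eq_bigr => a _; rewrite scale_lfunE cliffE /= scale1r -scalerAl -scalerAr.
  by rewrite -scalerDr !scalerA mulrC.
rewrite !cliffE /= !scale1r -scalerAl -scalerAr -scalerBr -scalerBr.
congr (_ *: _).
rewrite !(mulrBl, mulrBr, mulrDl, mulrDr) !mulrA.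
rewrite kp -[kap * w * p * kap]mulrA -kp !mulrA.
set t1 := G j c * w * p; set t2 := G j c * p * w; set t3 := kap * w * kap * p * G j c.
set t4 := kap * p * w * kap * G j c; set t5 := kap * w * kap * G j c * p.
set t6 := p * G j c * w; move: t1 t2 t3 t4 t5 t6 => t1 t2 t3 t4 t5 t6.
by apply/matrixP => a b; rewrite !mxE; ring.
Qed.

Lemma symbol_op_act x p : symbol_op (sym_act x p) = adG x * symbol_op p - symbol_op p * adG x.
Proof.
elim/mpoly_alg_ind: p => [|i p IH|a p q IHp IHq].
- by rewrite sym_act1 linear0 /symbol_op ceval1 mulr1 mul1r subrr.
- rewrite sym_actM sym_actX linearD /= !symbol_opM symbol_op_in IH commutatorM; congr (_ * _ + _ * _).
  + have -> : symbol_op 'X_i = wedge (vbasis {:g})`_i.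
      exact: (cevalX (fun i j => wedge_comm GG kapK kapG _ _)).
    rewrite /wedge mulr_sumr mulr_suml -sumrB; apply: eq_bigr => j _; symmetry.
    by apply: bivec_commutator => c; exact: adG_cliff.
- rewrite sym_act_linr !symbol_op_linear IHp IHq.
  move: (symbol_op p) (symbol_op q) (adG x) => u v w.
  by rewrite mulrDr mulrDl -(scalerAl a) -(scalerAr a) scalerBr opprD addrACA.
Qed.

Lemma symbol_map_act x p :
  symbol_map (sym_act x p) = spin x * symbol_map p - symbol_map p * spin x.
Proof.
rewrite /symbol_map symbol_op_act add_lfunE opp_lfunE !lfun_mulE !adGE.
by rewrite mul1r mulr1 subrr linear0 sub0r opprB.
Qed.

(** The kernel of [symbol_op] is an ideal by multiplicativity and so-stable by [symbol_op_act], so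
    the power of [e] alone decides. *)
Lemma symbol_map_relations (e : g) n : wedge e ^+ n.+1 = 0 ->
  forall p, C2_relations e n p -> symbol_map p = 0.
Proof.
move=> Te p Ip; suff : symbol_op p = 0 by rewrite /symbol_map => ->; rewrite zero_lfunE.
elim: Ip => [|r {}p q Op _ IH]; first by rewrite linear0.
rewrite linearD /= IH addr0 symbol_opM.
suff -> : symbol_op p = 0 by rewrite mulr0.
elim: Op => [|x {}p _ IHp|a p1 p2 _ IH1 _ IH2].
- have -> j : symbol_op (sym_in e ^+ j) = wedge e ^+ j.
    elim: j => [|j IHj]; first by rewrite !expr0 /symbol_op ceval1.
    by rewrite !exprS symbol_opM IHj symbol_op_in.
  exact: Te.
- by rewrite symbol_op_act IHp mulr0 mul0r subrr.
- by rewrite linearP /= IH1 IH2 scaler0 addr0.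
Qed.

(* Copy by copy, so_unit p q acts as a decomposable bivector, hence squares to 0. *)
Lemma wedge_nilpotent c (p q : 'I_N) : wedge (c *: so_unit K p q) ^+ k.+1 = 0.
Proof.
have sq0 a j : cliff (true, a) j * cliff (true, a) j = 0.
  have /eqP := cliff_anticomm GG kapK kapG (true, a) j (true, a) j.
  by rewrite /cliff_form andbF -mulr2n -scaler_nat scaler_eq0 pnatr_eq0 => /eqP.
have Te j : bivec (fun a => cliff (true, a) j) (c *: so_unit K p q) =
    (2 * c) *: (cliff (true, p) j * cliff (true, rev_ord q) j).
  have := bivecP (fun a => cliff (true, a) j) c (so_unit K p q) 0.
  have b0 : bivec (fun a => cliff (true, a) j) (0 : g) = 0.
    have := bivecP (fun a => cliff (true, a) j) (-1) (0 : g) 0.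
    by rewrite scaler0 addr0 scaleN1r addNr.
  rewrite addr0 b0 addr0 => ->; rewrite bivec_unit.
  by rewrite [cliff (true, rev_ord q) j * _]creationC // opprK -mulr2n -scaler_nat scalerA mulrC.
rewrite /wedge; apply: sum_sq0_nilpotent => [j|i j]; rewrite !Te.
  rewrite -scalerAl -scalerAr; set a := cliff (true, p) j; set b := cliff (true, _) j.
  have -> : a * b * (a * b) = 0.
    by rewrite -mulrA [b * (a * b)]mulrA [b * a]creationC // mulNr mulrN !mulrA sq0 !mul0r oppr0.
  by rewrite !scaler0.
by rewrite -!scalerAl -!scalerAr creation2C.
Qed.

End SymbolMap.

(** * Root vectors and weights *)

Section RootVectors.
Variables (K : numFieldType) (m : nat).
Local Notation N := m.*2.+1.
Local Notation g := (so K m).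
Implicit Types s t p a b : 'I_N.

(* The weight of the bivector u_s u_t, evaluated on the coroot of p. *)
Definition pair_weight s t p : K :=
  (s == p)%:R - (s == rev_ord p)%:R + ((t == p)%:R - (t == rev_ord p)%:R).

(** At [p = s] the left-hand weight is 1, while a pair not containing [s] has a nonpositive value
    there. *)
Lemma pair_weight_mem s t s' t' : s != t -> s != rev_ord t -> s != rev_ord s ->
  pair_weight s t s = pair_weight s' t' s -> (s == s') || (s == t').
Proof.
move=> st st' ss; rewrite /pair_weight eqxx (negPf ss).
rewrite [t == s]eq_sym (negPf st) [t == rev_ord s]eq_sym.
have -> : (rev_ord s == t) = false.
  by apply: contraNF st' => /eqP <-; rewrite rev_ordK.
rewrite !subr0 addr0; case: (eqVneq s s') => [//|ns] /=; case: (eqVneq s t') => [//|nt] /=.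
rewrite ?[s' == s]eq_sym ?(negPf ns) ?[t' == s]eq_sym ?(negPf nt) !sub0r -opprD => /eqP.
by rewrite -subr_eq0 opprK -!natrD pnatr_eq0.
Qed.

Lemma rev_ord_fix s t : s = rev_ord s -> t = rev_ord t -> s = t.
Proof.
move=> /(congr1 val) /= e1 /(congr1 val) /= e2; apply: val_inj => /=; lia.
Qed.

(** Root spaces are lines. The weight reveals every index except the middle one, which is the only
    fixed point of [rev_ord] and occurs at most once in a pair. *)
Lemma pair_weight_inj s t s' t' : s != t -> s != rev_ord t ->
  s' != t' -> s' != rev_ord t' ->
  (forall p, pair_weight s t p = pair_weight s' t' p) ->
  (s' = s /\ t' = t) \/ (s' = t /\ t' = s).
Proof.
move=> st sr st' sr' e.
have revne (x y : 'I_N) : x != rev_ord y -> y != rev_ord x.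
  by apply: contraNneq => ->; rewrite rev_ordK.
have pwC x y p : pair_weight x y p = pair_weight y x p by rewrite /pair_weight addrC.
have in_s : s != rev_ord s -> (s == s') || (s == t').
  by move=> ?; apply: (pair_weight_mem st sr).
have in_t : t != rev_ord t -> (t == s') || (t == t').
  move=> ?; apply: (@pair_weight_mem t s) => //; first by rewrite eq_sym.
    exact: revne.
  by rewrite pwC e.
have in_s' : s' != rev_ord s' -> (s' == s) || (s' == t).
  by move=> ?; apply: (pair_weight_mem st' sr').
have in_t' : t' != rev_ord t' -> (t' == s) || (t' == t).
  move=> ?; apply: (@pair_weight_mem t' s') => //; first by rewrite eq_sym.
    exact: revne.
  by rewrite pwC -e.
have fix1 (x : 'I_N) : x = rev_ord x \/ x != rev_ord x by case: (eqVneq x (rev_ord x)); auto.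
move: (st) (st') => /eqP nst /eqP nst'.
case: (fix1 s) (fix1 t) (fix1 s') (fix1 t') => [fs|/in_s/orP[]/eqP fs] [ft|/in_t/orP[]/eqP ft]
  [fs'|/in_s'/orP[]/eqP fs'] [ft'|/in_t'/orP[]/eqP ft']; 
  try (by have := rev_ord_fix fs ft); try (by have := rev_ord_fix fs' ft');
  try (have := rev_ord_fix fs fs'); try (have := rev_ord_fix fs ft');
  try (have := rev_ord_fix ft fs'); try (have := rev_ord_fix ft ft');
  clear in_s in_t in_s' in_t'; intuition congruence.
Qed.

Lemma weight_eval_coroot (alpha : 'rV[K]_m) (p : 'I_m) :
  weight_eval alpha (so_unit K (inord p) (inord p)) = alpha 0 p.
Proof.
have lt_i (i : 'I_m) : (i < N)%N by have := ltn_ord i; lia.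
have entry (i : 'I_m) : val (so_unit K (inord p) (inord p) : g) (inord i) (inord i) = (i == p)%:R.
  rewrite so_unitE !andbb -!val_eqE /= (inordK (lt_i i)) (inordK (lt_i p)).
  have -> : (i == N - p.+1 :> nat)%N = false.
    by apply/negbTE/negP => /eqP; have := ltn_ord i; have := ltn_ord p; lia.
  by rewrite subr0.
rewrite /weight_eval (bigD1 p) //= big1 => [|i ip].
  by rewrite entry eqxx mulr1 addr0.
by rewrite entry (negPf ip) mulr0.
Qed.

(** All nonzero entries of [x] have weight [alpha], so by [pair_weight_inj] they sit at one position
    (a, b) and its mirror image. *)
Lemma root_vector_unit alpha (x : g) : root_vector alpha x ->
  exists c a b, x = c *: so_unit K a b.
Proof.
move=> [al0 x0 hx].
have wE a b p : val x a b != 0 ->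
    weight_eval alpha (so_unit K p p) = pair_weight a (rev_ord b) p.
  move=> xab; have hp := unit_cartan K p.
  have := so_cartan_lbr x a b hp; rewrite (hx _ hp) valZ => /(mulIf xab) ->.
  rewrite !so_unitE !andbb /pair_weight; congr (_ + _).
  by rewrite opprB (inj_eq rev_ord_inj) (can2_eq rev_ordK rev_ordK).
have [a [b xab]] : exists a b, val x a b != 0.
  apply: contrapT => nx; move/eqP: x0; apply; apply: so_mtx_eq => a b.
  rewrite linear0 mxE; apply/eqP/negPn/negP => xab; apply: nx.
  by exists a, b.
have alE := weight_eval_coroot alpha.
(* Antisymmetry excludes the antidiagonal; a nonzero diagonal entry would make [alpha] zero. *)
have nd a' b' : val x a' b' != 0 -> a' != rev_ord b' /\ a' != b'.
  move=> xab'; split.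
    apply: contraNneq xab' => ->; have := so_entry x (rev_ord b') b'.
    rewrite !rev_ordK => /eqP; rewrite -addr_eq0 -mulr2n mulrn_eq0 /=.
    done.
  apply: contraNneq al0 => ab; apply/eqP/rowP => p; rewrite mxE -alE (wE _ _ _ xab') ab.
  by rewrite /pair_weight (inj_eq rev_ord_inj) (can2_eq rev_ordK rev_ordK) subrKA subrr.
have [n1 n2] := nd _ _ xab.
exists (val x a b), a, b; apply: so_mtx_eq => i j; rewrite valZ so_unitE.
have [|xij] := eqVneq (val x i j) 0; last first.
  have [n3 n4] := nd _ _ xij.
  have [||||p|[ia jb]|[ia jb]] := @pair_weight_inj a (rev_ord b) i (rev_ord j); rewrite ?rev_ordK //.
  - by rewrite -!wE.
  - have -> : j = b by apply: rev_ord_inj.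
    by rewrite ia !eqxx (negPf n1) subr0 mulr1.
  - have -> : j = rev_ord a by rewrite -jb rev_ordK.
    by rewrite ia eq_sym (negPf n1) !eqxx sub0r mulrN1 -so_entry.
move=> xij; rewrite xij.
have -> : (i == a) && (j == b) = false.
  by apply/negP => /andP[/eqP ia /eqP jb]; rewrite -ia -jb xij eqxx in xab.
have -> : (i == rev_ord b) && (j == rev_ord a) = false.
  apply/negP => /andP[/eqP ia /eqP jb]; move: xab.
  by rewrite -[val x a b]opprK -so_entry -ia -jb xij oppr0 eqxx.
by rewrite subrr mulr0.
Qed.
End RootVectors.

(** * Weights of the standard module and regular Cartan elements *)

Section Weights.
Variables (K : numFieldType) (m : nat).
Local Notation N := m.*2.+1.
Local Notation g := (so K m).

Lemma weight_evalD (al be : 'rV[K]_m) (h : g) :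
  weight_eval (al + be) h = weight_eval al h + weight_eval be h.
Proof. by rewrite -big_split; apply: eq_bigr => i _; rewrite mxE mulrDl. Qed.

Lemma weight_evalN (al : 'rV[K]_m) (h : g) : weight_eval (- al) h = - weight_eval al h.
Proof. by rewrite -sumrN; apply: eq_bigr => i _; rewrite mxE mulNr. Qed.

Lemma weight_eval_addr (al : 'rV[K]_m) (h h' : g) :
  weight_eval al (h + h') = weight_eval al h + weight_eval al h'.
Proof. by rewrite -big_split; apply: eq_bigr => i _; rewrite valD mulrDr. Qed.

Lemma weight_eval_eps (a : 'I_N) (h : g) : (a < m)%N ->
  weight_eval (eps_weight K m a) h = val h a a.
Proof.
move=> am; rewrite /weight_eval (bigD1 (Ordinal am)) //= big1 => [|i ia].
  by rewrite mxE eqxx mul1r addr0 inord_val.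
by rewrite mxE -(inj_eq val_inj) /= in ia *; rewrite (negPf ia) mul0r.
Qed.

(** The weight of the [l]-th standard basis vector; for l = m it is 0 since [eps_weight] vanishes at
    [m]. *)
Definition index_weight (l : nat) : 'rV[K]_m :=
  if (l < m)%N then eps_weight K m l else - eps_weight K m (m.*2 - l).

Lemma eps_weight_out i : (m <= i)%N -> eps_weight K m i = 0.
Proof.
move=> mi; apply/rowP => j; rewrite !mxE.
by have -> : (j == i :> nat) = false by have := ltn_ord j; lia.
Qed.

Lemma weight_eval_index (a : 'I_N) (h : g) :
  weight_eval (index_weight a) h = val h a a.
Proof.
rewrite /index_weight; case: ltnP => [|ma]; first exact: weight_eval_eps.
have ra : val (rev_ord a) = (m.*2 - a)%N by rewrite /= subSS.
rewrite weight_evalN -ra; have [am|ma'] := ltnP (val (rev_ord a)) m.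
  by rewrite weight_eval_eps // so_entry opprK.
have ea : rev_ord a = a by apply: val_inj; have := ltn_ord a; rewrite ra /=; lia.
rewrite ea eps_weight_out // /weight_eval big1 => [|i _]; last by rewrite mxE mul0r.
have := so_entry h a a; rewrite ea => /eqP; rewrite -addr_eq0 -mulr2n mulrn_eq0 /=.
by move=> /eqP ->; rewrite oppr0.
Qed.

Definition nonneg_root_sum (al : 'rV[K]_m) :=
  exists c : 'I_m -> nat, al = \sum_(i < m) simple_root K i *+ c i.

Lemma index_weight_step l : (l < m.*2)%N ->
  nonneg_root_sum (index_weight l - index_weight l.+1).
Proof.
move=> l2; have simple (i : 'I_m) : nonneg_root_sum (simple_root K i).
  exists (fun j => (j == i) : nat); rewrite (bigD1 i) //= eqxx mulr1n big1 ?addr0 // => j ji.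
  by rewrite (negPf ji).
rewrite /index_weight; case: (ltngtP l.+1 m) => lm.
- have lm' : (l < m)%N by exact: ltnW.
  by rewrite ?lm'; exact: (simple (Ordinal lm')).
- have lm' : (m.*2 - l.+1 < m)%N by lia.
  have -> : - eps_weight K m (m.*2 - l) - - eps_weight K m (m.*2 - l.+1) = simple_root K (Ordinal lm').
    rewrite opprK addrC /simple_root /=; congr (_ - eps_weight _ _ _); lia.
  exact: simple.
- have lm' : (l < m)%N by lia.
  rewrite ?lm' opprK; have -> : (m.*2 - l.+1 = m)%N by lia.
  rewrite (@eps_weight_out m) // addr0 -[eps_weight _ _ l]subr0 -(@eps_weight_out l.+1) ?lm //.
  by have := simple (Ordinal lm'); rewrite /simple_root /= lm.
Qed.

Lemma nonneg_root_sumD al be :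
  nonneg_root_sum al -> nonneg_root_sum be -> nonneg_root_sum (al + be).
Proof.
move=> [c ->] [d ->]; exists (fun i => c i + d i)%N.
by rewrite -big_split; apply: eq_bigr => i _; rewrite mulrnDr.
Qed.

Lemma index_weight_sub a b : (a <= b)%N -> (b <= m.*2)%N ->
  nonneg_root_sum (index_weight a - index_weight b).
Proof.
elim: b => [|b IH]; first by rewrite leqn0 => /eqP -> _; exists (fun=> 0%N);
  rewrite subrr big1.
rewrite leq_eqVlt => /predU1P[->|ab] bm.
  by rewrite subrr; exists (fun=> 0%N); rewrite big1.
rewrite -(subrKA (index_weight b)); apply: nonneg_root_sumD.
  by apply: IH => //; exact: ltnW.
exact: index_weight_step.
Qed.

(** The gap 3 leaves room for [regular_elt_coroot]: adding [so_unit K p p] changes a difference of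
    diagonal entries by at most 2. *)
Fact regular_subproof : \matrix_(a < N, b < N) ((a == b)%:R * (3 * (m%:R - a%:R))) \in so_space K m.
Proof.
apply/so_memP => a b; rewrite !mxE (inj_eq rev_ord_inj) eq_sym.
case: eqP => [->|_]; last by rewrite !mul0r oppr0.
rewrite !mul1r /= subSS natrB; last by have := ltn_ord a; lia.
have -> : m.*2%:R = m%:R + m%:R :> K by rewrite -addnn natrD.
by ring.
Qed.
Definition regular_elt : g := Subvs regular_subproof.

Lemma regular_eltE a b : val regular_elt a b = (a == b)%:R * (3 * (m%:R - a%:R)).
Proof. by rewrite /= mxE. Qed.

Lemma regular_elt_cartan : in_cartan regular_elt.
Proof. by apply/is_diag_mxP => a b ab; rewrite regular_eltE (inj_eq val_inj) in ab *; rewrite (negPf ab) mul0r. Qed.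

Lemma in_cartanD (h h' : g) : in_cartan h -> in_cartan h' -> in_cartan (h + h').
Proof.
move=> /is_diag_mxP hh /is_diag_mxP hh'; apply/is_diag_mxP => a b ab.
by rewrite valD hh // hh' // addr0.
Qed.

Lemma regular_elt_reg : regular_cartan regular_elt.
Proof.
split=> [|a b ab]; first exact: regular_elt_cartan.
exists (3 * (b - a)).-1%N; rewrite !regular_eltE !eqxx !mul1r prednK ?muln_gt0 ?subn_gt0 //.
by rewrite natrM natrB 1?ltnW //; ring.
Qed.

Lemma regular_elt_coroot (p : 'I_N) : regular_cartan (regular_elt + so_unit K p p).
Proof.
split=> [|a b ab]; first exact: (in_cartanD regular_elt_cartan (unit_cartan K p)).
pose q := ((3 * (b - a) + (a == p) + (b == rev_ord p)) - ((a == rev_ord p) + (b == p)))%N.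
exists q.-1; rewrite prednK; last first.
  by rewrite /q; case: (a == p); case: (b == p); case: (_ == _); case: (_ == _) => /=; lia.
rewrite !valD !regular_eltE !so_unitE !eqxx !andbb !mul1r /q natrB; last first.
  by case: (a == p); case: (b == p); case: (_ == _); case: (_ == _) => /=; lia.
by rewrite !natrD natrB 1?ltnW //; ring.
Qed.

(** Each coordinate of a weight is its value on a difference of two regular elements. *)
Lemma weight_separated (la mu : 'rV[K]_m) :
  (forall h : g, regular_cartan h -> weight_eval la h = weight_eval mu h) -> la = mu.
Proof.
move=> e; apply/rowP => p; rewrite -!weight_eval_coroot.
have := e _ (regular_elt_coroot (inord p)).
by rewrite !weight_eval_addr (e _ regular_elt_reg) => /addrI.
Qed.

Lemma highest_weight_singular (V : lmodType K) (rho : lieAction g V) la v :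
  highest_weight_vector rho la v -> singular_vector rho v.
Proof.
move=> [v0 hv pv]; split=> [h hh|a b ab]; first by exists (weight_eval la h); apply: hv.
case: (eqVneq a (rev_ord b)) => [arb|arb].
  have -> : so_unit K a b = 0; last by rewrite lact0l.
  apply: so_mtx_eq => i j; rewrite so_unitE arb rev_ordK subrr.
  by rewrite linear0 mxE.
have F0 : so_unit K a b != 0.
  apply/eqP => F0; have : val (so_unit K a b) a b = 0 by rewrite F0 linear0 mxE.
  by rewrite so_unitE !eqxx (negPf arb) subr0 => /eqP; rewrite oner_eq0.
have al0 : index_weight a - index_weight b != 0.
  have [_ /(_ a b ab)[s]] := regular_elt_reg; rewrite -!weight_eval_index => sE.
  apply/eqP => al0; have := weight_eval_index a regular_elt.
  have : weight_eval (index_weight a - index_weight b) regular_elt = 0.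
    by rewrite al0 /weight_eval big1 // => i _; rewrite mxE mul0r.
  rewrite weight_evalD weight_evalN sE addrC addKr => /eqP.
  by rewrite pnatr_eq0.
have rv : root_vector (index_weight a - index_weight b) (so_unit K a b).
  split=> // h hh; rewrite lbr_cartan_unit // weight_evalD weight_evalN.
  by rewrite !weight_eval_index.
apply: (pv _ _ _ rv); split; first by exists (so_unit K a b).
have [c ->] := index_weight_sub (ltnW ab) (ltnSE (ltn_ord b)).
by exists c; rewrite add0r.
Qed.

End Weights.

(** * Singular vectors in the spin module *)

Section Copies.
Variables (K : numFieldType) (m k D : nat) (iota : K).
Local Notation N := m.*2.+1.
Local Notation g := (so K m).
Local Notation E := 'M[K]_D.+1.
Variables (z : bool -> nat -> E) (kap : E).
Let n := (uphalf k * N)%N.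
Hypotheses (iota2 : iota * iota = -1)
  (zz : forall s t i j, (i < n)%N -> (j < n)%N ->
        z s i * z t j + z t j * z s i = ((s != t) && (i == j))%:R)
  (kz : forall s i, (i < n)%N -> kap * z s i = - (z s i * kap)).

Definition mode (p : nat) (a : 'I_N) : nat := (p * N + a)%N.
Definition modes s p a := z s (mode p a).

Lemma mode_lt p a : (p < uphalf k)%N -> (mode p a < n)%N.
Proof.
move=> pk; apply: (@leq_trans (p * N + N)); first by rewrite ltn_add2l.
by rewrite -mulSnr leq_mul2r pk orbT.
Qed.

Lemma mode_eq p q a b : (mode p a == mode q b) = (p == q) && (a == b).
Proof.
apply/eqP/andP => [e|[/eqP-> /eqP->]//].
have := congr1 (divn^~ N) e; have := congr1 (modn^~ N) e.
rewrite /= !modnMDl !divnMDl // !divn_small // !modn_small // !addn0.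
by move=> /val_inj -> ->.
Qed.

Lemma modesC s t p q a b : (p < uphalf k)%N -> (q < uphalf k)%N ->
  modes s p a * modes t q b + modes t q b * modes s p a =
  ((s != t) && ((p == q) && (a == b)))%:R.
Proof. by move=> pk qk; rewrite zz ?mode_lt // mode_eq. Qed.

(* Copies 2p and 2p+1 are the commuting left and right Clifford actions on the
   exterior algebra whose creation operators are the modes of level p. *)
Definition copy (j : 'I_k) (a : 'I_N) : E :=
  if odd j then iota *: (modes true j./2 a - modes false j./2 (rev_ord a))
  else modes true j./2 a + modes false j./2 (rev_ord a).

Lemma half_lt (j : 'I_k) : (j./2 < uphalf k)%N.
Proof. rewrite gtn_uphalf_double; have := ltn_ord j; have := odd_double_half j; lia. Qed.

Lemma copyG j a l b :
  copy j a * copy l b + copy l b * copy j a = (((j == l) && (b == rev_ord a))%:R *+ 2)%:M.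
Proof.
have hj := half_lt j; have hl := half_lt l.
pose d := ((j./2 == l./2) && (b == rev_ord a))%:R : E.
have e1 s t : modes s j./2 (if s then a else rev_ord a) * modes t l./2 (if t then b else rev_ord b)
    + modes t l./2 (if t then b else rev_ord b) * modes s j./2 (if s then a else rev_ord a)
    = if s != t then d else 0.
  rewrite modesC // /d; case: s; case: t => //=.
  - by rewrite [a == _]eq_sym (can2_eq rev_ordK rev_ordK).
  - by rewrite [rev_ord a == b]eq_sym.
(* Each copy is [ci] times (creation + [sg] annihilation). Copies of opposite parity anticommute
   because their [sg] cancel; for equal parity the constant is 2 because ci^2 = sg. *)
pose sg (j : 'I_k) : K := if odd j then -1 else 1.
pose ci (j : 'I_k) : K := if odd j then iota else 1.
have cE (i : 'I_k) c : copy i c = ci i *: (modes true i./2 c + sg i *: modes false i./2 (rev_ord c)).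
  by rewrite /copy /ci /sg; case: (odd i); rewrite ?scaleN1r ?scale1r.
rewrite !cE -!scalerAl -!scalerAr !scalerA [ci l * _]mulrC -scalerDr.
rewrite !mulrDl !mulrDr -!scalerAl -!scalerAr !scalerA.
have := e1 true true; have := e1 true false; have := e1 false true; have := e1 false false.
rewrite /=.
set c1 := modes true j./2 a; set d1 := modes false j./2 _.
set c2 := modes true l./2 b; set d2 := modes false l./2 _ => dd dc cd cc.
have -> : c1 * c2 + sg l *: (c1 * d2) + (sg j *: (d1 * c2) + (sg j * sg l) *: (d1 * d2)) +
   (c2 * c1 + sg j *: (c2 * d1) + (sg l *: (d2 * c1) + (sg l * sg j) *: (d2 * d1))) =
   (c1 * c2 + c2 * c1) + sg l *: (c1 * d2 + d2 * c1) + sg j *: (d1 * c2 + c2 * d1)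
   + (sg j * sg l) *: (d1 * d2 + d2 * d1).
  rewrite [sg l * sg j]mulrC !scalerDr.
  move: (c1 * c2) (c2 * c1) (sg l *: (c1 * d2)) (sg l *: (d2 * c1)) (sg j *: (d1 * c2))
    (sg j *: (c2 * d1)) (_ *: (d1 * d2)) (_ *: (d2 * d1)) => t1 t2 t3 t4 t5 t6 t7 t8.
  by apply/matrixP => ? ?; rewrite !mxE; ring.
rewrite cc dd cd dc scaler0 addr0 add0r -scalerDl scalerA.
have jl : (j == l) = (odd j == odd l) && (j./2 == l./2).
  apply/eqP/andP => [->//|[/eqP o /eqP h]]; apply: val_inj => /=.
  by rewrite -[LHS]odd_double_half -[RHS]odd_double_half o h.
rewrite jl /d /sg /ci; case: (odd j); case: (odd l); case: (j./2 == l./2); case: (b == _) => /=;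
  rewrite ?(mul0rn, scaler0, raddf0, subrr, addNr, mulr0, scale0r, mulr1n) //.
- by rewrite iota2 -opprD mulrNN mul1r -scalemx1 mulr2n.
- by rewrite !mul1r -scalemx1 mulr2n.
Qed.

Lemma kap_copy j a : kap * copy j a = - (copy j a * kap).
Proof.
have kzm s b : kap * modes s j./2 b = - (modes s j./2 b * kap).
  by apply: kz; apply: mode_lt; exact: half_lt.
rewrite /copy; case: (odd j).
  by rewrite -scalerAr -scalerAl mulrBr mulrBl !kzm -scalerN opprB opprK addrC.
by rewrite mulrDr mulrDl !kzm opprD.
Qed.

Section FilledState.
Variables (occ : nat -> nat) (v : 'cV[K]_D.+1) (x : g).
Hypotheses (vA : forall i, (i < n)%N -> z (i %% N < occ (i %/ N))%N i *m v = 0)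
  (x_up : forall a b : 'I_N, (b < a)%N -> val x a b = 0).

Lemma mode_occ p (a : 'I_N) : ((mode p a) %% N < occ ((mode p a) %/ N))%N = (a < occ p)%N.
Proof. by rewrite /mode modnMDl divnMDl // modn_small // divn_small // addn0. Qed.

Lemma modes_killl p (a : 'I_N) : (p < uphalf k)%N -> (a < occ p)%N -> modes true p a *m v = 0.
Proof. by move=> pk ap; have := vA (mode_lt a pk); rewrite mode_occ ap. Qed.

Lemma modes_killr p (a : 'I_N) : (p < uphalf k)%N -> (occ p <= a)%N -> modes false p a *m v = 0.
Proof. by move=> pk ap; have := vA (mode_lt a pk); rewrite mode_occ ltnNge ap. Qed.

Lemma diag_antisym a : val x (rev_ord a) (rev_ord a) = - val x a a.
Proof. exact: so_entry. Qed.

Lemma diag_sum0 : \sum_a val x a a = 0.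
Proof.
have : \sum_a val x a a = - \sum_a val x a a.
  rewrite {1}(reindex_inj rev_ord_inj) -sumrN; apply: eq_bigr => a _.
  exact: diag_antisym.
by move/eqP; rewrite -addr_eq0 -mulr2n mulrn_eq0 /= => /eqP.
Qed.

(** Products of two creations or two annihilations cancel between the copies, so [x] acts on the
    exterior algebra by a number-preserving operator. On a state filled from the bottom, strictly
    upper triangular entries give 0 and diagonal ones count filled modes. *)
Lemma pair_copies (j0 j1 : 'I_k) p : j0 = p.*2 :> nat -> j1 = p.*2.+1 :> nat ->
  (bivec (copy j0) x + bivec (copy j1) x) *m v =
  (4 * \sum_(a : 'I_N | (a < occ p)%N) val x a a) *: v.
Proof.
move=> e0 e1; have pk : (p < uphalf k)%N by have := half_lt j0; rewrite e0 doubleK.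
pose c a := modes true p a; pose d a := modes false p a.
have cpE a b : copy j0 a * copy j0 (rev_ord b) + copy j1 a * copy j1 (rev_ord b) =
    2 *: (c a * d b + d (rev_ord a) * c (rev_ord b)).
  rewrite /copy e0 e1 /= odd_double /= uphalf_double doubleK rev_ordK -/(c a) -/(d b).
  rewrite -/(c (rev_ord b)) -/(d (rev_ord a)) -scalerAl -scalerAr scalerA iota2 scaleN1r.
  rewrite !(mulrDl, mulrDr, mulNr, mulrN) opprK.
  move: (c a * c _) (c a * d b) (d _ * c _) (d _ * d b) => t1 t2 t3 t4.
  by apply/matrixP => ? ?; rewrite !mxE; ring.
have term (a b : 'I_N) : val x a b *: ((c a * d b + d (rev_ord a) * c (rev_ord b)) *m v) =
    (val x a b * ((a == b) && (a < occ p)%N + (a == b) && (occ p <= rev_ord a)%N)%N%:R) *: v.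
  have [ba|ab] := ltnP b a; first by rewrite x_up // scale0r mul0r scale0r.
  rewrite -scalerA; congr (_ *: _).
  rewrite mulmxDl natrD scalerDl -!mulmxE -!mulmxA; congr (_ + _).
    have [ob|ob] := leqP (occ p) b.
      rewrite modes_killr // mulmx0; case: eqP => [->|]; last by rewrite scale0r.
      by rewrite ltnNge ob scale0r.
    have oa := leq_ltn_trans ab ob.
    rewrite mulmxA mulmxE -[c a * d b](addrK (d b * c a)) modesC //= mulmxBl -mulmxE -mulmxA.
    rewrite modes_killl // mulmx0 subr0 eqxx oa andbT /=; by case: (a == b); rewrite ?scale1r ?mul1mx ?scale0r ?mul0mx.
  have rab : (rev_ord b <= rev_ord a)%N by rewrite leq_sub2l.
  have [ob|ob] := ltnP (rev_ord b) (occ p).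
    rewrite modes_killl // mulmx0; case: eqP => [->|]; last by rewrite scale0r.
    by rewrite leqNgt ob scale0r.
  rewrite mulmxA mulmxE -[d _ * c _](addrK (c (rev_ord b) * d (rev_ord a))) modesC //=.
  have oa := leq_trans ob rab.
  rewrite mulmxBl -mulmxE -mulmxA modes_killr // mulmx0 subr0 eqxx oa andbT.
  rewrite (inj_eq rev_ord_inj) /=.
  by case: (a == b); rewrite ?scale1r ?mul1mx ?scale0r ?mul0mx.
rewrite /bivec -big_split mulmx_suml /=; move: term => /= term.
have sw (u : K) (X : 'cV[K]_D.+1) : u *: (2 *: X) = 2 *: (u *: X) by rewrite !scalerA mulrC.
transitivity (\sum_a (2 * (val x a a * ((a < occ p)%N + (occ p <= rev_ord a)%N)%N%:R)) *: v).
  apply: eq_bigr => a _; rewrite -big_split mulmx_suml (bigD1 a) //= big1 => [|b ba].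
    rewrite addr0 -scalerDr cpE -!scalemxAl sw.
    by rewrite term eqxx /= scalerA.
  rewrite -scalerDr cpE -!scalemxAl sw term.
  by rewrite eq_sym (negPf ba) mulr0 scale0r scaler0.
rewrite -scaler_suml -mulr_sumr; congr (_ *: _).
have -> : \sum_a val x a a * ((a < occ p) + (occ p <= rev_ord a))%N%:R =
   \sum_a val x a a * (a < occ p)%N%:R + \sum_a val x a a * (occ p <= rev_ord a)%N%:R.
  by rewrite -big_split; apply: eq_bigr => a _; rewrite natrD mulrDr.
(* Antisymmetry turns this into minus the sum over the empty modes, which is the sum over the filled
   ones as the trace is zero. *)
have -> : \sum_a val x a a * (occ p <= rev_ord a)%N%:R = \sum_a val x a a * (a < occ p)%N%:R.
  rewrite (reindex_inj rev_ord_inj).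
  under eq_bigr => a _ do rewrite rev_ordK diag_antisym leqNgt.
  rewrite -[LHS]addr0 -[X in _ + X = _]diag_sum0 -big_split /=.
  by apply: eq_bigr => a _; case: (a < occ p)%N; rewrite ?(mulr0, mulr1) ?addNr ?add0r.
have -> : \sum_a val x a a * (a < occ p)%N%:R = \sum_(a : 'I_N | (a < occ p)%N) val x a a.
  by rewrite [RHS]big_mkcond; apply: eq_bigr => a _; case: ltnP; rewrite ?(mulr0, mulr1).
by rewrite mulrDr -mulrDl -natrD.
Qed.

(** A pure spinor: for a < m, mode [a] is filled and its mirror mode is empty, so [copy j a] kills
    [v]. *)
Lemma single_copy (j : 'I_k) p : j = p.*2 :> nat -> occ p = m ->
  bivec (copy j) x *m v = (2 * \sum_(a : 'I_N | (a < m)%N) val x a a) *: v.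
Proof.
move=> ej om; have pk : (p < uphalf k)%N by have := half_lt j; rewrite ej doubleK.
have kill (a : 'I_N) : (a < m)%N -> copy j a *m v = 0.
  move=> am; rewrite /copy ej odd_double doubleK mulmxDl modes_killl ?om // modes_killr ?addr0 //.
  by rewrite om /=; lia.
have term (a b : 'I_N) : val x a b *: ((copy j a * copy j (rev_ord b)) *m v) =
    ((2 * val x a b) * ((a == b) && (a < m)%N)%:R) *: v.
  have [ba|ab] := ltnP b a; first by rewrite x_up // scale0r mulr0 mul0r scale0r.
  have [mb|bm] := ltnP m b.
    rewrite -mulmxE -mulmxA kill ?mulmx0 ?scaler0; last by rewrite /=; have := ltn_ord b; lia.
    case: eqP => [->|]; last by rewrite mulr0 scale0r.
    by rewrite ltnNge (ltnW mb) mulr0 scale0r.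
  have [am|am] := ltnP a m; last first.
    have eb : b = a by apply: val_inj => /=; lia.
    have ra : rev_ord a = a by apply: val_inj => /=; lia.
    have := diag_antisym a; rewrite ra eb => /eqP.
    by rewrite -addr_eq0 -mulr2n mulrn_eq0 /= => /eqP ->; rewrite mulr0 mul0r !scale0r.
  rewrite -[copy j a * _](addrK (copy j (rev_ord b) * copy j a)) copyG mulmxBl.
  rewrite -mulmxE -mulmxA kill // mulmx0 subr0 eqxx (inj_eq rev_ord_inj) mul_scalar_mx scalerA.
  rewrite andbT [b == a]eq_sym [2 * _]mulrC -mulrA; congr ((_ * _) *: _).
  by rewrite mulr_natl.
rewrite /bivec mulmx_suml.
transitivity (\sum_(a : 'I_N) (2 * (val x a a * (a < m)%N%:R)) *: v).
  apply: eq_bigr => a _; rewrite mulmx_suml (bigD1 a) //= big1 => [|b ba].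
    by rewrite addr0 -scalemxAl term eqxx /= mulrA.
  by rewrite -scalemxAl term eq_sym (negPf ba) mulr0 scale0r.
rewrite -scaler_suml -mulr_sumr; congr ((_ * _) *: _).
by rewrite [RHS]big_mkcond; apply: eq_bigr => a _; case: ltnP; rewrite ?(mulr0, mulr1).
Qed.

End FilledState.

End Copies.

Section Pairing.
Variables (V : nmodType) (F : nat -> V).

Lemma sum_pairs_double q :
  \sum_(i < q.*2) F i = \sum_(p < q) (F p.*2 + F p.*2.+1).
Proof.
elim: q => [|q IH]; first by rewrite !big_ord0.
by rewrite doubleS !big_ord_recr /= IH addrA.
Qed.

Lemma sum_pairs k : \sum_(i < k) F i =
  \sum_(p < k./2) (F p.*2 + F p.*2.+1) + (if odd k then F k./2.*2 else 0).
Proof.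
rewrite -sum_pairs_double -[in LHS](odd_double_half k); case: (odd k).
  by rewrite add1n big_ord_recr.
by rewrite add0n addr0.
Qed.

Lemma sum_nth_pad q (s : seq nat) : F 0 = 0 -> (size s <= q)%N ->
  \sum_(p < q) F (nth 0%N s p) = \sum_(x <- s) F x.
Proof.
move=> F0 sq; rewrite (big_nth 0%N) big_mkord [RHS](big_ord_widen q (fun p => F (nth 0%N s p))) //.
rewrite [RHS]big_mkcond; apply: eq_bigr => p _; case: ltnP => // ps.
by rewrite nth_default.
Qed.

End Pairing.

Section FundamentalWeights.
Variables (K : numFieldType) (m : nat).
Local Notation N := m.*2.+1.
Local Notation g := (so K m).

Definition head_trace (h : g) (t : nat) : K := \sum_(a : 'I_N | (a < t)%N) val h a a.

Lemma fundamental_weight_eval (i : 'I_m) (h : g) :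
  weight_eval (fundamental_weight K i) h =
  if i.+1 == m then 2^-1 * head_trace h m else head_trace h i.+1.
Proof.
pose G j := val h (inord j : 'I_N) (inord j).
have HE t : (t <= m)%N -> head_trace h t = \sum_(j < t) G j.
  move=> tm; rewrite (big_ord_widen N G); last by lia.
  by apply: eq_bigr => a _; rewrite /G inord_val.
rewrite /weight_eval /fundamental_weight; case: ifP => im.
  by rewrite HE // mulr_sumr; apply: eq_bigr => j _; rewrite mxE.
rewrite HE // (big_ord_widen m G) // [RHS]big_mkcond; apply: eq_bigr => j _.
by rewrite mxE ltnS; case: leqP; rewrite ?mul1r ?mul0r.
Qed.

Lemma weight_of_eval (a : {ffun 'I_m -> nat}) (h : g) :
  weight_eval (weight_of K a) h = \sum_i (a i)%:R * weight_eval (fundamental_weight K i) h.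
Proof.
rewrite /weight_eval; under [RHS]eq_bigr => i _ do rewrite mulr_sumr.
rewrite exchange_big; apply: eq_bigr => j _ /=.
rewrite /weight_of summxE mulr_suml; apply: eq_bigr => i _.
by rewrite mulmxnE -[in LHS]mulr_natl mulrA.
Qed.

End FundamentalWeights.

Section WeightInjective.
Variables (K : numFieldType) (n : nat).

(** The last coordinate of the weight is a_m / 2, and consecutive differences give the other
    coefficients. *)
Lemma weight_of_inj (a b : {ffun 'I_n.+1 -> nat}) :
  weight_of K a = weight_of K b -> a = b.
Proof.
move=> /rowP e.
have fwE (i j : 'I_n.+1) : fundamental_weight K i 0 j =
    if i == ord_max then 2^-1 else (j <= i)%N%:R.
  by rewrite /fundamental_weight eqSS -val_eqE /=; case: ifP; rewrite mxE.
have wE (c : {ffun 'I_n.+1 -> nat}) j : weight_of K c 0 j =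
    (c ord_max)%:R / 2 + \sum_(i | i != ord_max) (c i)%:R * (j <= i)%N%:R.
  rewrite /weight_of summxE (bigD1 ord_max) //=; congr (_ + _).
    by rewrite mulmxnE fwE eqxx mulr_natl.
  by apply: eq_bigr => i ni; rewrite mulmxnE fwE (negPf ni) [RHS]mulr_natl.
have last0 (c : {ffun 'I_n.+1 -> nat}) : weight_of K c 0 ord_max = (c ord_max)%:R / 2.
  rewrite wE big1 ?addr0 // => i ni; have -> : ((ord_max : 'I_n.+1) <= i)%N = false.
    apply: contraNF ni => /= h; apply/eqP/val_inj => /=; have := ltn_ord i; lia.
  by rewrite mulr0.
have nz2 : (2 : K) != 0 by rewrite pnatr_eq0.
apply/ffunP => i; have [->|ni] := eqVneq i ord_max.
  have := e ord_max; rewrite !last0 => /(mulIf (invr_neq0 nz2)) /eqP.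
  by rewrite eqr_nat => /eqP.
have lt_i : (i.+1 < n.+1)%N.
  by rewrite ltnS ltn_neqAle -ltnS ltn_ord andbT; move: ni; rewrite -val_eqE.
have step (c : {ffun 'I_n.+1 -> nat}) :
    weight_of K c 0 i - weight_of K c 0 (Ordinal lt_i) = (c i)%:R.
  rewrite !wE opprD addrACA subrr add0r -sumrB (bigD1 i) //= big1 => [|j /andP[_ ji]].
    by rewrite leqnn ltnn mulr1 mulr0 subr0 addr0.
  rewrite -mulrBr ltn_neqAle; move: ji; rewrite -val_eqE eq_sym => -> /=.
  by rewrite subrr mulr0.
by have := step a; rewrite !e step => /eqP; rewrite eqr_nat => /eqP.
Qed.

End WeightInjective.

Section SpinSingular.
Variables (K : numFieldType) (m k D : nat) (iota : K).
Local Notation N := m.*2.+1.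
Local Notation g := (so K m).
Local Notation E := 'M[K]_D.+1.
Variables (z : bool -> nat -> E).
Hypotheses (iota2 : iota * iota = -1)
  (zz : forall s t i j, (i < uphalf k * N)%N -> (j < uphalf k * N)%N ->
        z s i * z t j + z t j * z s i = ((s != t) && (i == j))%:R).
Variables (occ : nat -> nat) (v : 'cV[K]_D.+1).
Hypothesis vA : forall i, (i < uphalf k * N)%N -> z (i %% N < occ (i %/ N))%N i *m v = 0.
Hypothesis occ_last : odd k -> occ k./2 = m.
Local Notation G := (@copy K m k D iota z).

Definition spin_weight (x : g) : K := \sum_(p < k./2) head_trace x (occ p)
  + (odd k)%:R * (2^-1 * head_trace x m).

(** Upper triangular [x] covers Cartan elements and positive root vectors in one computation. *)
Lemma spin_upper (x : g) : (forall a b : 'I_N, (b < a)%N -> val x a b = 0) ->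
  spin G x *m v = spin_weight x *: v.
Proof.
move=> x_up; rewrite /spin -scalemxAl mulmx_suml.
(* Extended by 0 to all naturals, so that the sum over copies can be regrouped into pairs. *)
pose F i := oapp (fun j : 'I_k => bivec (G j) x *m v) 0 (insub i).
have FE (j : 'I_k) : bivec (G j) x *m v = F j by rewrite /F valK.
under eq_bigr => j _ do rewrite FE.
rewrite sum_pairs.
have -> : \sum_(p < k./2) (F p.*2 + F p.*2.+1) = (4 * \sum_(p < k./2) head_trace x (occ p)) *: v.
  rewrite mulr_sumr scaler_suml; apply: eq_bigr => p _.
  have lt1 : (p.*2.+1 < k)%N by have := odd_double_half k; have := ltn_ord p; lia.
  have lt0 : (p.*2 < k)%N by exact: ltnW.
  rewrite -[p.*2]/(val (Ordinal lt0)) -[X in F X.+1]/(p.*2) -[p.*2.+1]/(val (Ordinal lt1)) -!FE.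
  by rewrite -mulmxDl (pair_copies iota2 zz vA x_up (p := p)).
have -> : (if odd k then F k./2.*2 else 0) = (4 * ((odd k)%:R * (2^-1 * head_trace x m))) *: v.
  case: ifP => ok; last by rewrite mul0r mulr0 scale0r.
  have lt0 : (k./2.*2 < k)%N by have := odd_double_half k; rewrite ok; lia.
  rewrite -[k./2.*2]/(val (Ordinal lt0)) -FE (single_copy iota2 zz vA x_up (p := k./2)) //; last exact: occ_last.
  congr (_ *: _); rewrite mul1r mulrA; congr (_ * _).
  by rewrite -[4]/((2 * 2)%N%:R) natrM mulfK // pnatr_eq0.
by rewrite -scalerDl -mulrDr scalerA mulrA mulVf ?mul1r // pnatr_eq0.
Qed.

Lemma spin_singular :
  (forall h : g, in_cartan h -> spinAction (copyG iota2 zz) h v = spin_weight h *: v) /\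
  singular_vector (spinAction (copyG iota2 zz)) v.
Proof.
have cart (h : g) : in_cartan h -> spinAction (copyG iota2 zz) h v = spin_weight h *: v.
  move=> /is_diag_mxP hd; apply: spin_upper => a b ab; apply: hd.
  by rewrite neq_ltn ab orbT.
split=> //; split=> [h hh|a b ab]; first by exists (spin_weight h); apply: cart.
suff w0 : spin_weight (so_unit K a b) = 0.
  rewrite [LHS]spin_upper ?w0 ?scale0r // => i j ji; rewrite so_unitE.
  have -> : (i == a) && (j == b) = false.
    by apply/negbTE/negP => /andP[/eqP ia /eqP jb]; move: ji; rewrite ia jb ltnNge ltnW.
  have -> : (i == rev_ord b) && (j == rev_ord a) = false.
    apply/negbTE/negP => /andP[/eqP ia /eqP jb].
    by move: ji; rewrite ia jb ltnNge leq_sub2l // ltnW.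
  by rewrite subrr.
have ht0 t : head_trace (so_unit K a b) t = 0.
  apply: big1 => i _; rewrite so_unitE.
  have -> : (i == a) && (i == b) = false.
    by apply/negbTE/negP => /andP[/eqP ia /eqP ib]; move: ab; rewrite -ia -ib ltnn.
  have -> : (i == rev_ord b) && (i == rev_ord a) = false.
    by apply/negbTE/negP => /andP[/eqP ia]; rewrite ia => /eqP/rev_ord_inj ib; move: ab; rewrite ib ltnn.
  by rewrite subrr.
by rewrite /spin_weight big1 => [|p _]; rewrite ?ht0 // !mulr0 addr0.
Qed.

End SpinSingular.

(** * The surjection *)

Section Occupations.
Variables (K : numFieldType) (n k : nat) (a : admissible_index n k).

(** The number of pairs filled to level i + 1. The last coefficient is halved because a pair filled
    to level m has weight 2 omega_m. *)
Definition multiplicity (i : 'I_n.+1) : nat :=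
  if i == ord_max then (coefs a i)./2 else coefs a i.

Definition fill_levels : seq nat :=
  flatten [seq nseq (multiplicity i) i.+1 | i <- enum 'I_n.+1].

Lemma coefs_max_odd : odd (coefs a ord_max) = odd k.
Proof.
have /andP[_] := valP a; rewrite ffunE !modn2.
by case: (odd k); case: (odd _).
Qed.

(** Twice the number of pairs in use is at most the left-hand side of the admissibility
    inequality. *)
Lemma fill_levels_size : (size fill_levels <= k./2)%N.
Proof.
have /andP[le_k _] := valP a.
rewrite geq_half_double size_flatten /shape -map_comp sumnE big_map big_enum /=.
under eq_bigr => i _ do rewrite size_nseq.
apply: leq_trans le_k; rewrite (bigD1 ord_max) //= doubleD addnC leq_add //.
  rewrite -mul2n big_distrr /=; apply: leq_sum => i ni.
  by rewrite /multiplicity (negPf ni) ffunE.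
by rewrite /multiplicity eqxx ffunE -geq_half_double.
Qed.

Lemma fill_levels_sum (F : nat -> K) :
  \sum_(x <- fill_levels) F x = \sum_i (multiplicity i)%:R * F i.+1.
Proof.
rewrite big_flatten big_map big_enum; apply: eq_bigr => i _.
by rewrite big_nseq iter_addr_0 mulr_natl.
Qed.

(** Pairs beyond the list stay empty through the default 0. Level [k./2] is filled to m for the
    unpaired copy of an odd k. *)
Definition occupation (p : nat) : nat :=
  if (p < k./2)%N then nth 0%N fill_levels p else n.+1.

Lemma occupation_weight (h : so K n.+1) :
  spin_weight k occupation h = weight_eval (weight_of K (coefs a)) h.
Proof.
rewrite /spin_weight weight_of_eval.
have -> : \sum_(p < k./2) head_trace h (occupation p) =
    \sum_(p < k./2) head_trace h (nth 0%N fill_levels p).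
  by apply: eq_bigr => p _; rewrite /occupation ltn_ord.
rewrite sum_nth_pad ?fill_levels_size //; last first.
  by rewrite /head_trace big1 // => i; rewrite ltn0.
rewrite fill_levels_sum (bigD1 ord_max) //= [RHS](bigD1 ord_max) //= addrAC; congr (_ + _).
  rewrite fundamental_weight_eval eqxx /multiplicity eqxx mulrA -mulrDl mulrA; congr (_ * _).
  (* The odd part of a_m equals that of k and is supplied by the unpaired copy. *)
  rewrite -{2}[coefs a ord_max]odd_double_half coefs_max_odd -muln2 natrD natrM mulrDl mulfK ?pnatr_eq0 //.
  by rewrite addrC.
apply: eq_bigr => i ni; rewrite /multiplicity (negPf ni) fundamental_weight_eval.
by rewrite eqSS -val_eqE /= in ni *; rewrite (negPf ni).
Qed.

End Occupations.

(** * Endomorphisms as elements of the tensor product with the dual *)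

Section EndToTensor.
Variables (K : fieldType) (g : lieAlgebra K) (V : vectType K) (rho : lieAction g V).
Let b := vbasis {:V}.

Definition dual_basis (i : 'I_(\dim {:V})) : dual_mod V := linfun (coord b i : V -> K^o).

Lemma dual_basisE i v : dual_basis i v = coord b i v.
Proof. by rewrite lfunE. Qed.

(** Defined on bare functions, so that [uev] can be inserted directly; linearity is required only
    where it matters. *)
Definition end_tens (F : V -> V) : tens_mod V (dual_mod V) :=
  \sum_(i < \dim {:V}) pure_tens (F b`_i) (dual_basis i).

Lemma dual_expand (w : dual_mod V) : w = \sum_(i < \dim {:V}) (w b`_i : K) *: dual_basis i.
Proof.
apply/lfunP => v; rewrite sum_lfunE {1}(coord_vbasis (memvf v)) linear_sum.
apply: eq_bigr => i _; rewrite scale_lfunE dual_basisE linearZ /=.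
exact: mulrC.
Qed.

Lemma end_tens_linear c (F H : V -> V) :
  end_tens (fun v => c *: F v + H v) = c *: end_tens F + end_tens H.
Proof.
by rewrite /end_tens scaler_sumr -big_split; apply: eq_bigr => i _; rewrite pure_tens_linl.
Qed.

Lemma pure_tensZr c (v : V) (w : dual_mod V) : pure_tens v (c *: w) = c *: pure_tens v w.
Proof. by apply/matrixP => i j; rewrite !mxE linearZ /= mulrCA. Qed.

Lemma end_tens_act x (F : V -> V) : linear F ->
  tens_act rho (dualAction rho) x (end_tens F) =
  end_tens (fun v => rho x (F v) - F (rho x v)).
Proof.
move=> linF; pose LF : {linear V -> V} := HB.pack F (GRing.isLinear.Build K V V _ F linF).
rewrite /end_tens linear_sum /=.
under eq_bigr => i _ do rewrite tens_act_pure.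
under [RHS]eq_bigr => i _ do rewrite pure_tensBl.
rewrite big_split sumrB; congr (_ + _).
under eq_bigr => i _ do rewrite /= [dual_act rho x (dual_basis i)]dual_expand linear_sum.
rewrite exchange_big -sumrN; apply: eq_bigr => j _ /=.
rewrite -[F _]/(LF _) [rho x _ in RHS](coord_vbasis (memvf (rho x b`_j))) linear_sum /=.
rewrite pure_tens_suml -sumrN; apply: eq_bigr => i _.
have Fz c u : F (c *: u) = c *: F u by exact: (linearZ_LR LF).
by rewrite pure_tensZr Fz pure_tensZl dual_actE dual_basisE scaleNr.
Qed.

Lemma end_tens_surj (t : tens_mod V (dual_mod V)) :
  exists2 F : V -> V, linear F & end_tens F = t.
Proof.
pose P t := exists2 F : V -> V, linear F & end_tens F = t.
have Plin c t1 t2 : P t1 -> P t2 -> P (c *: t1 + t2).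
  move=> [F1 l1 <-] [F2 l2 <-]; exists (fun v => c *: F1 v + F2 v); last exact: end_tens_linear.
  move=> d u v; rewrite l1 l2 !scalerDr !scalerA [c * d]mulrC -!scalerA addrACA.
  by [].
have P0 : P 0.
  exists (fun=> 0); first by move=> c u v; rewrite scaler0 addr0.
  rewrite /end_tens big1 // => i _; apply/matrixP => p q.
  by rewrite !mxE linear0 mul0r.
rewrite -/(P t) (tens_pure_sum t); apply: (pred_sum P0 Plin) => i _.
apply: (pred_sum P0 Plin) => j _; apply: (pred_scale P0 Plin).
set w := (vbasis _)`_j; exists (fun v => (w v : K) *: b`_i).
  by move=> c u v; rewrite linearP scalerDl scalerA.
rewrite [in RHS](dual_expand w) linear_sum /end_tens; apply: eq_bigr => l _.
by rewrite pure_tensZl -pure_tensZr.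
Qed.

End EndToTensor.

(** * Density for the sum of the modules V(lambda) *)

Section Assembly.
Variables (K : numFieldType) (n k : nat) (iota : K).
Hypothesis iota2 : iota * iota = -1.
Local Notation m := n.+1.
Local Notation g := (so K m).
Variables (V : {ffun 'I_m -> nat} -> vectType K) (rho : forall a, lieAction g (V a)).
Hypothesis hV : forall a, irreducible_of_highest_weight (rho a) (weight_of K a).
Local Notation I := (admissible_index n k).

Lemma coefs_inj : injective (@coefs n k).
Proof.
move=> a b /ffunP e; apply/val_inj/ffunP => i; apply: val_inj.
by have := e i; rewrite !ffunE.
Qed.

(** Distinct weights differ on a regular [h], where each eigenvalue cannot lie below the other. If
    it is that of [a] which lies below, separate in the opposite direction and take 1 - u. *)
Lemma separating (a b : I) : a != b ->
  exists2 u, (forall y, uev (rho (coefs b)) u y = 0) & (forall y, uev (rho (coefs a)) u y = y).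
Proof.
move=> ab; have [ia [va hwa]] := hV (coefs a); have [ib [vb hwb]] := hV (coefs b).
have [h hr ne] : exists2 h : g, regular_cartan h &
    weight_eval (weight_of K (coefs a)) h != weight_eval (weight_of K (coefs b)) h.
  apply: contrapT => nh; move/eqP: ab; apply; apply: coefs_inj.
  apply: (@weight_of_inj K); apply: weight_separated => h hr.
  by apply/eqP/negPn/negP => ne; apply: nh; exists h.
have sa := highest_weight_singular hwa; have sb := highest_weight_singular hwb.
move: hwa hwb => [va0 ha _] [vb0 hb _].
have ea := ha _ hr.1; have eb := hb _ hr.1.
set ca := weight_eval _ h in ne ea; set cb := weight_eval _ h in ne eb.
have [below|above] := pselect (exists j, ca = cb - j%:R); last first.
  apply: (hw_separated ia va0 sa ea ib vb0 sb eb hr) => j; apply/eqP => e.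
  by apply: above; exists j.
have [u ua ub] : exists2 u, (forall y, uev (rho (coefs a)) u y = 0) &
    (forall y, uev (rho (coefs b)) u y = y).
  apply: (hw_separated ib vb0 sb eb ia va0 sa ea hr) => j; apply/eqP => e.
  have [l el] := below; move/eqP: ne; apply.
  have : (j + l)%:R = 0 :> K.
    have -> : (j + l)%:R = cb - (cb - l%:R - j%:R) by rewrite natrD; ring.
    by rewrite -el -e subrr.
  by move/eqP; rewrite pnatr_eq0 addn_eq0 => /andP[_ /eqP l0]; rewrite el l0 subr0.
exists (UAdd (UC 1) (UMul (UC (-1)) u)) => y /=.
  by rewrite ub scale1r scaleN1r subrr.
by rewrite ua scale1r scaler0 addr0.
Qed.

Lemma uev_uprod (W : lmodType K) (sigma : lieAction g W) (T : eqType) (s : seq T) F y :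
  (forall i, i \in s -> forall y, uev sigma (F i) y = y) -> uev sigma (uprod s F) y = y.
Proof.
elim: s => [|i s IH] Fy /=; first by rewrite scale1r.
rewrite (Fy i) ?mem_head // IH // => j js; apply: Fy.
by rewrite inE js orbT.
Qed.

Lemma uev_uprod0 (W : lmodType K) (sigma : lieAction g W) (T : eqType) (s : seq T) F i y :
  i \in s -> (forall y, uev sigma (F i) y = 0) -> uev sigma (uprod s F) y = 0.
Proof.
move=> + Fi; elim: s => [//|j s IH]; rewrite inE => /predU1P[<-|/IH e] /=.
  exact: Fi.
by rewrite e uev0.
Qed.

Lemma isolating (a : I) : exists2 u, (forall y, uev (rho (coefs a)) u y = y) &
  forall b, b != a -> forall y, uev (rho (coefs b)) u y = 0.
Proof.
have /choice[F FP] (b : I) : exists u, b != a ->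
    (forall y, uev (rho (coefs b)) u y = 0) /\ (forall y, uev (rho (coefs a)) u y = y).
  case: (eqVneq b a) => [_|ba]; first by exists (UC 1).
  by have [|u u0 u1] := @separating a b; [rewrite eq_sym | exists u].
exists (uprod [seq b <- enum {: I} | b != a] F) => [y|b ba y].
  by apply: uev_uprod => b; rewrite mem_filter => /andP[/FP[]].
have [F0 _] := FP b ba.
by apply: (uev_uprod0 (i := b)) => //; rewrite mem_filter ba mem_enum.
Qed.

(** Burnside's theorem gives each component separately; the isolating elements glue them as in the
    Chinese remainder theorem. *)
Lemma density (F : forall a : I, V (coefs a) -> V (coefs a)) :
  (forall a, linear (F a)) -> exists u, forall a y, uev (rho (coefs a)) u y = F a y.
Proof.
move=> linF.
have /choice[s sP] (a : I) : exists s, uev (rho (coefs a)) s =1 F a.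
  have [ia [va hwa]] := hV (coefs a).
  have := highest_weight_burnside ia _ (highest_weight_singular hwa) (regular_elt_reg K m).
  by move: hwa => [va0 ha _]; apply=> //; apply: ha; exact: regular_elt_cartan.
have /choice[e eP] (a : I) : exists u, (forall y, uev (rho (coefs a)) u y = y) /\
    forall b, b != a -> forall y, uev (rho (coefs b)) u y = 0.
  by have [u u1 u2] := isolating a; exists u.
exists (usum (fun a => UMul (s a) (e a))) => a y.
rewrite uev_usum (bigD1 a) //= big1 => [|b ba].
  by rewrite (eP a).1 sP addr0.
by rewrite (eP b).2 ?uev0 // eq_sym.
Qed.

End Assembly.

Lemma end_tens_ext (K : fieldType) (V : vectType K) (F H : V -> V) :
  F =1 H -> end_tens F = end_tens H.
Proof. by move=> e; apply: eq_bigr => i _; rewrite e. Qed.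

Section QuotientMap.
Variables (K : fieldType) (V W : lmodType K) (J : subspace V) (F : V -> W).
Hypotheses (linF : linear F) (FJ : forall v, J v -> F v = 0).

Definition quot_map (q : lquot J) : W := F (repr q).

Lemma quot_mapE v : quot_map (lproj J v) = F v.
Proof.
apply/eqP; rewrite -subr_eq0; apply/eqP.
have -> : quot_map (lproj J v) - F v = F (repr (lproj J v) - v).
  by have := linF (-1) v (repr (lproj J v)); rewrite !scaleN1r ![- _ + _]addrC => ->.
apply: FJ; apply/asboolP; move: (lproj_eq J (repr (lproj J v)) v).
by rewrite lprojK eqxx => /esym.
Qed.

Lemma quot_map_linear : linear quot_map.
Proof.
move=> c p q; rewrite -[p]lprojK -[q]lprojK -linearP !quot_mapE.
exact: linF.
Qed.

End QuotientMap.

Section Surjection.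
Variables (K : numFieldType) (n k : nat) (iota : K).
Hypothesis iota2 : iota * iota = -1.
Local Notation m := n.+1.
Local Notation N := m.*2.+1.
Local Notation g := (so K m).
Variables (V : {ffun 'I_m -> nat} -> vectType K) (rho : forall a, lieAction g (V a)).
Hypothesis hV : forall a, irreducible_of_highest_weight (rho a) (weight_of K a).
Local Notation I := (admissible_index n k).

Lemma C2_surjection (e : g) c p q : e = c *: so_unit K p q ->
  exists f : {linear C2_algebra e k ->
                dsum (fun a : I => tens_mod (V (coefs a)) (dual_mod (V (coefs a))))},
    is_surjective f /\
    equivariant (C2_action e k)
      (dsumAction (fun a : I =>
         tensAction (rho (coefs a)) (dualAction (rho (coefs a))))) f.
Proof.
move=> eE.
have [D [z [kap [zz kk kz zv]]]] := fock_space K (uphalf k * N).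
pose G := @copy K m k D iota z.
have GG := copyG iota2 zz.
have kapG := kap_copy iota kz.
(* The filled state and the highest weight vector have the same weight, so [kernel_incl] compares
   the kernels. *)
have ker u (a : I) : umx G u = 0 -> forall y, uev (rho (coefs a)) u y = 0.
  move=> u0; have [va v0 vA] := zv (fun i => (i %% N < occupation a (i %/ N))%N).
  have occ_last : odd k -> occupation a k./2 = m by rewrite /occupation ltnn.
  have [cw sw] := spin_singular iota2 zz vA occ_last.
  have [irr [w hw]] := hV (coefs a); have sv := highest_weight_singular hw.
  case: hw => w0 hw _.
  apply: (kernel_incl irr w0 v0 sv sw _ (regular_elt_reg K m)) => [h b hh hb|y].
    rewrite cw // occupation_weight; congr (_ *: _).
    by move: hb; rewrite hw // => /eqP; rewrite -subr_eq0 -scalerBl scaler_eq0 (negPf w0) orbF subr_eq0 => /eqP.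
  by rewrite uev_umx u0 mul0mx.
have uniq u u' (a : I) : umx G u = umx G u' -> uev (rho (coefs a)) u =1 uev (rho (coefs a)) u'.
  move=> uu y; apply/eqP; rewrite -subr_eq0 -scaleN1r; apply/eqP.
  apply: (ker (UAdd u (UMul (UC (-1)) u')) a _ y).
  by rewrite /= uu -mulmxE mul_scalar_mx scaleN1r subrr.
have /choice[U UE] p' : exists u, umx G u = symbol_map G kap p'.
  by apply/(in_symbols_spin GG kk kapG); exists p'.
(* The action on each V of an element of U(so) having the symbol of [p'] as its matrix on S; by
   [uniq] the choice [U] does not matter. *)
pose F p' : dsum (fun a : I => tens_mod (V (coefs a)) (dual_mod (V (coefs a)))) :=
  [ffun a => end_tens (uev (rho (coefs a)) (U p'))].
have FE p' u : umx G u = symbol_map G kap p' ->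
    F p' = [ffun a => end_tens (uev (rho (coefs a)) u)].
  by move=> up; apply/ffunP => a; rewrite !ffunE; apply: end_tens_ext; apply: uniq; rewrite UE.
have linF : linear F.
  move=> d p1 p2; rewrite (FE _ (UAdd (UMul (UC d) (U p1)) (U p2))); last first.
    by rewrite /= -mulmxE mul_scalar_mx !UE linearP.
  by apply/ffunP => a; rewrite !ffunE -end_tens_linear.
have FJ p' : C2_ideal e k p' -> F p' = 0.
  move=> Ip; rewrite (FE _ (UC 0)) /=.
    apply/ffunP => a; rewrite !ffunE /end_tens big1 // => i _.
    by apply/matrixP => ? ?; rewrite !mxE scale0r linear0 mul0r.
  rewrite raddf0; symmetry; apply: (symbol_map_relations GG kk kapG _ Ip).
  by rewrite eE; exact: wedge_nilpotent.
pose f0 := quot_map F.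
have linf : linear (f0 (C2_ideal e k)) := quot_map_linear linF FJ.
pose f : {linear C2_algebra e k ->
                dsum (fun a : I => tens_mod (V (coefs a)) (dual_mod (V (coefs a))))} :=
   HB.pack (f0 (C2_ideal e k)) (GRing.isLinear.Build K _ _ _ (f0 (C2_ideal e k)) linf).
exists f; split=> [t|x r].
  have [H HP] : exists H : forall a : I, V (coefs a) -> V (coefs a),
      forall a, linear (H a) /\ end_tens (H a) = t a.
    have ex (a : I) : exists H : V (coefs a) -> V (coefs a), linear H /\ end_tens H = t a.
      by have [H l1 l2] := end_tens_surj (t a); exists H.
    by exists (fun a => projT1 (cid (ex a))) => a; case: (cid (ex a)).
  (* Density realises [t] by an element of U(so), and its matrix on S is a symbol. *)
  have [u uE] := density hV (fun a => (HP a).1).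
  have [p' pE] : in_symbols G kap (umx G u).
    by apply/(in_symbols_spin GG kk kapG); exists u.
  exists (lproj _ p'); rewrite -[f _]/(quot_map F (lproj _ p')) quot_mapE // (FE _ u) ?pE //.
  apply/ffunP => a; rewrite ffunE -(HP a).2; apply: end_tens_ext => y.
  exact: uE.
rewrite -[r]lprojK; set p' := repr r.
rewrite -[f (lproj _ p')]/(quot_map F (lproj _ p')) quot_mapE //.
rewrite -[C2_action _ _ _ _]/(quot_act (symAction g) x (lproj (C2_ideal e k) p')).
rewrite quot_actE; last by move=> *; exact: C2_ideal_stable.
rewrite -[f _]/(quot_map F (lproj _ (sym_act x p'))) quot_mapE //.
(* [x] acts by commutators on both sides: with [spin x] on symbols, with [x] itself on End V. *)
rewrite (FE _ (UAdd (UMul (UX x) (U p')) (UMul (UC (-1)) (UMul (U p') (UX x))))); last first.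
  by rewrite /= symbol_map_act // UE -!mulmxE mul_scalar_mx scaleN1r.
apply/ffunP => a; rewrite !ffunE /= end_tens_act; last exact: uev_lin.
by apply: end_tens_ext => y /=; rewrite scaleN1r.
Qed.

End Surjection.

Theorem proposition5p14 (R : realType) (n k : nat)
    (e : so R[i] n.+1) (he : highest_root_vector e)
    (V : {ffun 'I_n.+1 -> nat} -> vectType R[i])
    (rho : forall a, lieAction (so R[i] n.+1) (V a))
    (hV : forall a,
      irreducible_of_highest_weight (rho a) (weight_of R[i] a)) :
  exists f : {linear C2_algebra e k ->
                dsum (fun a : admissible_index n k =>
                        tens_mod (V (coefs a)) (dual_mod (V (coefs a))))},
    is_surjective f /\
    equivariant (C2_action e k)
      (dsumAction (fun a : admissible_index n k =>
         tensAction (rho (coefs a)) (dualAction (rho (coefs a))))) f.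
Proof.
have [alpha _ re] := he.
have i2 : ('i%C : R[i]) * 'i%C = -1 by rewrite -expr2 sqr_i.
have [c [p [q eE]]] := @root_vector_unit R[i] n.+1 alpha e re.
exact: (@C2_surjection R[i] n k _ i2 V rho hV e c p q eE).
Qed.
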